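(* Let $(M^{2n+k},\mathcal D^{2n})$ be a fat manifold. (i) If $u:S\to(M,\mathcal D)$ is a preisotropic immersion, then there exists a unique isotropic immersion $\hat u:S\to\mathcal C_{\mathbb P}(M,\mathcal D)$ whose composition with the projection $\mathcal C_{\mathbb P}(M,\mathcal D)\to M$ equals $u$. (ii) If $u:S\to(M,\mathcal D)$ is a co-oriented preisotropic immersion, then there exists a unique isotropic immersion $\widetilde u:S\to\mathcal C(M,\mathcal D)$ that makes the diagram formed by $\widetilde u$, $\hat u$, $u$ and the projections $\mathcal C(M,\mathcal D)\to\mathcal C_{\mathbb P}(M,\mathcal D)\to M$ commute; that is, the composition of $\widetilde u$ with the double cover $\mathcal C(M,\mathcal D)\to\mathcal C_{\mathbb P}(M,\mathcal D)$ is $\hat u$, and its composition with the projection to $M$ is $u$. Moreover, if $u$ is an embedding, then $\hat u$ and $\widetilde u$ are also embeddings.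
   Context: $S$ is a smooth manifold. A distribution $\mathcal D\subseteq TM$ of rank $2n$ and corank $k$ is fat, and $(M,\mathcal D)$ is a fat manifold, if for every local nowhere-zero section $\alpha$ of $\mathcal D^\perp=\{\alpha\in T^*M:\alpha|_{\mathcal D}=0\}$, $d\alpha|_{\mathcal D}$ is symplectic on $\mathcal D$. $\mathbb S\mathcal D^\perp=(\mathcal D^\perp\setminus0)/\mathbb R^+$ and $\mathbb P\mathcal D^\perp=(\mathcal D^\perp\setminus0)/\mathbb R^*$ are the spaces of co-oriented, respectively unoriented, hyperplanes containing $\mathcal D$, with projection $\pi$ to $M$; both carry the contact structure $\xi_{can}([\alpha])=(d\pi)^{-1}(\ker\alpha)$. Put $\mathcal C(M,\mathcal D)=(\mathbb S\mathcal D^\perp,\xi_{can})$ (the contactisation) and $\mathcal C_{\mathbb P}(M,\mathcal D)=(\mathbb P\mathcal D^\perp,\xi_{can})$ (the projectivised contactisation); the natural map $\mathcal C(M,\mathcal D)\to\mathcal C_{\mathbb P}(M,\mathcal D)$ is a contact double cover. An immersion into a contact manifold is isotropic if it is tangent to the contact structure. An immersion $u:S\to M$ is preisotropic if $H_p=du(T_pS)+\mathcal D_{u(p)}$ has constant corank 1 in $T_{u(p)}M$. A preisotropic co-orientation of $u$ is a co-orientation of $H$, i.e. an orientation of the line bundle $u^*TM/H$; $u$ is co-oriented if such a co-orientation has been fixed.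
   Formalization: In (ii), uniqueness is for lifts whose co-oriented hyperplane at each p is H_p with the given co-orientation; with only the commuting diagram, composing with the antipodal map [α]↦[−α] gives a second lift. *)

(* Defs.v *)
(* Smooth manifolds are given by an atlas together with a preferred chart
   around each point; the tangent space at [p] is R^m, a tangent vector being
   identified with its (row vector of) coordinates in the preferred chart
   [chart_at p].  Covectors are column vectors, paired by [v *m a]. *)
From HB Require Import structures.
From mathcomp Require Import all_boot all_order all_algebra.
From mathcomp Require Import all_classical all_reals all_analysis.

Set Implicit Arguments.
Unset Strict Implicit.
Unset Printing Implicit Defensive.

Import Order.TTheory GRing.Theory Num.Theory.
Import numFieldNormedType.Exports.

Local Open Scope classical_set_scope.
Local Open Scope ring_scope.

Section Smoothness.
Context {R : realType} {V : normedModType R}.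

Fixpoint Ck m (r : nat) (O : set 'rV[R]_m) (F : 'rV[R]_m -> V) : Prop :=
  if r is r'.+1 then
    (forall x, O x -> differentiable F x) /\
    (forall v, Ck r' O (fun x => 'd F x v))
  else forall x, O x -> {for x, continuous F}.

Definition smooth_at m (F : 'rV[R]_m -> V) (x : 'rV[R]_m) : Prop :=
  exists O : set 'rV[R]_m, [/\ open O, O x & forall r, Ck r O F].

End Smoothness.

Record chart (R : realType) (m : nat) (T : Type) := Chart {
  dom : set T;
  chart_map :> T -> 'rV[R]_m }.

Record charted (R : realType) (m : nat) := Charted {
  pts :> topologicalType;
  atlas : set (chart R m pts);
  chart_at : pts -> chart R m pts }.

Section Manifold.
Context {R : realType} {m : nat} {M : charted R m}.

(* The inverse of the chart [phi], with junk value [p] off its image. *)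
Definition coord (phi : chart R m M) (p : M) (x : 'rV[R]_m) : M :=
  xget p [set q | dom phi q /\ phi q = x].

Definition is_chart (phi : chart R m M) : Prop :=
  [/\ open (dom phi),
      {in dom phi &, injective phi},
      forall p, dom phi p -> {for p, continuous phi} &
      forall O : set M, open O -> O `<=` dom phi -> open (phi @` O)].

(* Coordinate change of tangent vectors at [p], from [phi] to [psi]. *)
Definition tcoord (phi psi : chart R m M) (p : M) : 'M[R]_m :=
  'J (psi \o coord phi p) (phi p).

(* A family of [r] vector fields is given by the [r] rows of a matrix;
   [X] is read in the preferred chart at [p]. *)
Definition vect_in r (X : M -> 'M[R]_(r, m)) (p : M) (x : 'rV[R]_m) :
    'M[R]_(r, m) :=
  let q := coord (chart_at p) p x in
  X q *m tcoord (chart_at q) (chart_at p) q.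

Definition smooth_vect r (O : set M) (X : M -> 'M[R]_(r, m)) : Prop :=
  forall p, O p -> smooth_at (vect_in X p) (chart_at p p).

Definition form_in (a : M -> 'cV[R]_m) (p : M) (x : 'rV[R]_m) : 'cV[R]_m :=
  let q := coord (chart_at p) p x in
  tcoord (chart_at p) (chart_at q) q *m a q.

Definition smooth_form (O : set M) (a : M -> 'cV[R]_m) : Prop :=
  forall p, O p -> smooth_at (form_in a p) (chart_at p p).

(* d a (v, w) = v (a w) - w (a v) for constant fields v, w in the preferred
   chart at [p]. *)
Definition ext_deriv (a : M -> 'cV[R]_m) (p : M) (v w : 'rV[R]_m) : R :=
  let da := 'd (form_in a p) (chart_at p p) in
  (w *m da v - v *m da w) 0 0.

End Manifold.

Definition is_manifold (R : realType) (m : nat) (M : charted R m) : Prop :=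
  [/\ hausdorff_space M, @second_countable M,
      forall p : M, atlas (chart_at p) /\ dom (chart_at p) p,
      forall phi : chart R m M, atlas phi -> is_chart phi &
      forall (phi psi : chart R m M) (p : M), atlas phi -> atlas psi ->
        dom phi p -> dom psi p -> smooth_at (psi \o coord phi p) (phi p)].

Section Maps.
Context {R : realType} {s m : nat} {S : charted R s} {M : charted R m}.
Implicit Type f : S -> M.

Definition map_in f (p : S) : 'rV[R]_s -> 'rV[R]_m :=
  chart_at (f p) \o f \o coord (chart_at p) p.

Definition smooth_map f : Prop :=
  continuous f /\ forall p, smooth_at (map_in f p) (chart_at p p).

(* The differential of [f] at [p] is [v |-> v *m mdiff f p]. *)
Definition mdiff f (p : S) : 'M[R]_(s, m) := 'J (map_in f p) (chart_at p p).

Definition immersion f : Prop :=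
  smooth_map f /\ forall p, row_free (mdiff f p).

Definition embedding f : Prop :=
  [/\ immersion f, injective f &
      forall O : set S, open O -> exists2 O' : set M, open O' & O = f @^-1` O'].

End Maps.

Section Distributions.
Context {R : realType} {m : nat} {M : charted R m}.
(* The distribution at [p] is the row space of [D p]. *)
Implicit Type D : M -> 'M[R]_m.

Definition distribution D (r : nat) : Prop :=
  (forall p, \rank (D p) = r) /\
  forall p, exists O : set M, exists X : M -> 'M[R]_(r, m),
    [/\ open O, O p, smooth_vect O X & forall q, O q -> (X q == D q)%MS].

Definition annihilates D (p : M) (a : 'cV[R]_m) : Prop := D p *m a = 0.

(* [d a] is alternating, so being symplectic on D amounts to nondegeneracy. *)
Definition fat D : Prop :=
  forall (O : set M) (a : M -> 'cV[R]_m), open O -> smooth_form O a ->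
    (forall p, O p -> a p != 0 /\ annihilates D p (a p)) ->
    forall p, O p -> forall v, (v <= D p)%MS ->
      (forall w, (w <= D p)%MS -> ext_deriv a p v w = 0) -> v = 0.

Definition fat_manifold D (r : nat) : Prop :=
  [/\ is_manifold M, distribution D r & fat D].

End Distributions.

Definition Rpos {R : realType} : set R := [set c | 0 < c].
Definition Rnz {R : realType} : set R := [set c | c != 0].

(* (D^perp \ 0) / G for a group G of nonzero scalars: a point is a point of M
   together with a G-orbit of nonzero covectors annihilating D there.  The
   parameter [k], the corank of D, only fixes the dimension of its charts. *)
Record hyp_space (R : realType) (m : nat) (M : charted R m) (k : nat)
    (G : set R) (D : M -> 'M[R]_m) := HypSpace {
  foot : M;
  ray : set 'cV[R]_m;
  rayP : exists a, [/\ a != 0, annihilates D foot a &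
                      ray = [set c *: a | c in G]] }.

Section Contactisation.
Context {R : realType} {m : nat} {M : charted R m}.
Variables (k : nat) (G : set R) (D : M -> 'M[R]_m).
Local Notation hyp := (hyp_space k G D).

(* Around a hyperplane [a] at [p], choose in a chart phi of M a constant field
   w and k - 1 constant fields W which together span a complement of D, and
   with a w in G. Then [a] has the coordinates (phi p, (a W_i / a w)_i), which
   do not depend on the representative: they are affine coordinates for the
   homogeneous coordinates (a w : a W_1 : ... : a W_(k-1)) on the fibre. *)
Definition hyp_dom (phi : chart R m M) (w : 'rV[R]_m) (W : 'M[R]_(k.-1, m)) :
    set hyp :=
  [set q | let p := foot q in let J := tcoord phi (chart_at p) p in
    [/\ dom phi p, row_full (D p + w *m J + W *m J)%MS &
        forall a, ray q a -> G ((w *m J *m a) 0 0)]].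

Definition hyp_coord (phi : chart R m M) (w : 'rV[R]_m) (W : 'M[R]_(k.-1, m))
    (q : hyp) : 'rV[R]_(m + k.-1) :=
  let p := foot q in let J := tcoord phi (chart_at p) p in
  let a := xget 0 (ray q) in
  row_mx (phi p) (((w *m J *m a) 0 0)^-1 *: (W *m J *m a)^T).

Definition hyp_chart phi w W : chart R (m + k.-1) hyp :=
  Chart (hyp_dom phi w W) (hyp_coord phi w W).

Definition hyp_atlas : set (chart R (m + k.-1) hyp) :=
  [set c | exists phi w W, atlas phi /\ c = hyp_chart phi w W].

Definition hyp_chart_at (q : hyp) : chart R (m + k.-1) hyp :=
  let phi := chart_at (foot q) in
  let wW := xget (0, 0) [set wW | hyp_dom phi wW.1 wW.2 q] in
  hyp_chart phi wW.1 wW.2.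

HB.instance Definition _ := gen_eqMixin hyp.
HB.instance Definition _ := gen_choiceMixin hyp.

(* The topology of the atlas. *)
Definition hyp_subbase : set (set hyp) :=
  [set A | exists c : chart R (m + k.-1) hyp, exists O : set 'rV[R]_(m + k.-1),
    [/\ hyp_atlas c, open O & A = dom c `&` c @^-1` O]].

HB.instance Definition _ := isSubBaseTopological.Build hyp hyp_subbase id.

Definition hyp_manifold : charted R (m + k.-1) :=
  Charted hyp_atlas hyp_chart_at.

Definition hyp_proj (q : hyp_manifold) : M := foot (q : hyp).

Definition xi_can (q : hyp_manifold) : set 'rV[R]_(m + k.-1) :=
  [set v | forall a, ray (q : hyp) a -> v *m mdiff hyp_proj q *m a = 0].

Definition isotropic_immersion s (S : charted R s) (f : S -> hyp_manifold) :
    Prop :=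
  immersion f /\ forall p v, xi_can (f p) (v *m mdiff f p).

End Contactisation.

Section Main.
Context {R : realType} {m : nat} {M : charted R m}.
Variables (k : nat) (D : M -> 'M[R]_m).

Definition contactisation := hyp_manifold k Rpos D.
Definition pcontactisation := hyp_manifold k Rnz D.

Lemma double_coverP (q : hyp_space k Rpos D) :
  exists a, [/\ a != 0, annihilates D (foot q) a &
    [set c *: a | c in Rnz & a in ray q] = [set c *: a | c in Rnz]].
Proof.
have [a [a0 Da ->]] := rayP q; exists a; split=> //.
apply/seteqP; split=> x /=.
  move=> [c c0 [_ [d d0 <-] <-]]; exists (c * d); last by rewrite scalerA.
  by rewrite /Rnz /= mulf_neq0// gt_eqF.
move=> [c c0 <-]; exists c => //; exists a => //.
by exists 1; rewrite ?scale1r// /Rpos /=.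
Qed.

Definition double_cover (q : contactisation) : pcontactisation :=
  HypSpace k (double_coverP q).

Section Preisotropic.
Context {s : nat} {S : charted R s}.
Implicit Type u : S -> M.

Definition pre_hyp u (p : S) : 'M[R]_m := (mdiff u p + D (u p))%MS.

Definition preisotropic u : Prop :=
  immersion u /\ forall p, (\rank (pre_hyp u p)).+1 = m.

(* An orientation of the line bundle u^*TM / H: [co p] is the set of vectors
   whose class is positive. It is an open ray of the fibre (pulled back to
   T_(u p) M), and has local continuous sections. *)
Definition coorientation u (co : S -> set 'rV[R]_m) : Prop :=
  (forall p, exists2 v : 'rV[R]_m, ~~ (v <= pre_hyp u p)%MS &
    co p = [set c *: v + h | c in Rpos &
                             h in [set h | (h <= pre_hyp u p)%MS]]) /\
  forall p, exists O : set S, exists X : S -> 'rV[R]_m,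
    [/\ open O, O p, forall q, O q -> co q (X q) &
        forall q, O q -> {for q, continuous (fun q' : S =>
          X q' *m tcoord (chart_at (u q')) (chart_at (u q)) (u q'))}].

Definition isotropic_lift u (uh : S -> pcontactisation) : Prop :=
  isotropic_immersion uh /\ (@hyp_proj _ _ _ _ _ _) \o uh = u.

(* The last clause: the hyperplane [ut p], co-oriented by its covectors, is
   H_p with the given co-orientation.  Commutation of the diagram alone would
   not distinguish [ut] from its composition with the antipodal map. *)
Definition cooriented_isotropic_lift u (co : S -> set 'rV[R]_m)
    (uh : S -> pcontactisation) (ut : S -> contactisation) : Prop :=
  [/\ isotropic_immersion ut, double_cover \o ut = uh,
      (@hyp_proj _ _ _ _ _ _) \o ut = u &
      forall p a, ray (ut p : hyp_space k Rpos D) a ->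
        co p = [set v | 0 < (v *m a) 0 0]].

End Preisotropic.
End Main.

(* Main.v *)
(* Since H_p has corank 1, its annihilator is a line, and any isotropic lift of
   u must send p to that line (to the ray picked out by the co-orientation in
   the co-oriented case): this gives uniqueness and the pointwise definition of
   the lift.  For smoothness, read everything in charts near p0: the covectors
   in question are the solutions of K a = 0, where the rows of K are a frame of
   D along u and the Jacobian of u; adding the equation w a = 1 makes the system
   of full rank, so its solution is a smooth function of the point by Cramer's
   rule.  The charts of the contactisation are onto neighbourhoods, so that its
   projection to M is a linear projection in charts; hence du factors through
   the differential of the lift, which is therefore injective and tangent to
   the contact structure.  If u is an embedding, so is any immersed lift, as the
   projection is continuous. *)
Require Import Defs.
From HB Require Import structures.
From mathcomp Require Import all_boot all_order all_algebra.
From mathcomp Require Import all_classical all_reals all_analysis.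

Set Implicit Arguments.
Unset Strict Implicit.
Unset Printing Implicit Defensive.

Import Order.TTheory GRing.Theory Num.Theory.
Import numFieldNormedType.Exports.

Local Open Scope classical_set_scope.
Local Open Scope ring_scope.

Local Notation coord := Defs.coord.
Local Notation distribution := Defs.distribution.

(** * Smooth functions of several variables *)

Section NearDiff.
Context {R : numFieldType} {V W : normedModType R}.

(** The first-order expansion of [f] at [x] is also one for [g], and its continuous linear part is
    unique. *)
Lemma near_eq_differentiable (f g : V -> W) (x : V) :
  (\forall y \near x, f y = g y) -> differentiable f x ->
  differentiable g x /\ 'd g x = 'd f x :> (V -> W).
Proof.
move=> fg /[dup] df /diff_locallyP [cd fE].
have gE : g \o shift x = cst (g x) + 'd f x +o_ 0 id.
  apply/eqaddoP => e e0; move/eqaddoP: fE => /(_ e e0).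
  have fg0 : \forall y \near 0, f (y + x) = g (y + x).
    by move: fg; rewrite (near_shift 0 x) subr0; apply: filterS.
  have fgx : f x = g x by exact: nbhs_singleton fg.
  by apply: filterS2 fg0 => y /= ye; rewrite /= !fctE /= ye fgx.
have dg := diff_unique cd gE.
by split=> //; apply/diff_locallyP; rewrite dg.
Qed.

End NearDiff.

Section CkCalculus.
Context {R : realType} {m : nat}.
Implicit Types (O : set 'rV[R]_m) (x v : 'rV[R]_m) (r : nat).

Section General.
Context {V : normedModType R}.
Implicit Types F G : 'rV[R]_m -> V.

Lemma Ck_sub O O' r F : O' `<=` O -> Ck r O F -> Ck r O' F.
Proof.
elim: r F => [|r IH] F sub /=; first by move=> h x /sub /h.
by move=> [h1 h2]; split=> [x /sub /h1 //|v]; exact: IH.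
Qed.

Lemma CkW O r F : Ck r.+1 O F -> Ck r O F.
Proof.
elim: r F => [|r IH] F /= [h1 h2].
  by move=> x /h1; exact: differentiable_continuous.
by split=> // v; apply: IH; exact: h2.
Qed.

(** As [O] is open, equality on [O] is equality near each of its points, so it passes to derivatives
    and the induction goes through. *)
Lemma Ck_eq O r F G : open O -> (forall x, O x -> F x = G x) ->
  Ck r O F -> Ck r O G.
Proof.
move=> oO; have near x : O x -> \forall y \near x, O y.
  by move=> Ox; apply: open_nbhs_nbhs.
elim: r F G => [|r IH] F G FG /=.
  move=> h x Ox; rewrite /prop_for /continuous_at -FG//.
  apply: cvg_trans (h x Ox); apply: near_eq_cvg; first exact: nbhs_filter.
  by apply: filterS (near _ Ox) => y; exact: FG.
have FGn x : O x -> \forall y \near x, F y = G y.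
  by move=> Ox; apply: filterS (near _ Ox) => y; exact: FG.
move=> [h1 h2]; split.
  by move=> x Ox; case: (near_eq_differentiable (FGn _ Ox) (h1 _ Ox)).
move=> v; apply: IH (h2 v) => x Ox.
by case: (near_eq_differentiable (FGn _ Ox) (h1 _ Ox)) => _ ->.
Qed.

Lemma Ck_cst O r (a : V) : Ck r O (fun=> a).
Proof.
elim: r a => [|r IH] a /=; first by move=> x _; exact: cst_continuous.
split=> [x _|v]; first exact: differentiable_cst.
by under eq_fun => x do rewrite diff_cst; exact: IH.
Qed.

Lemma CkD O r F G : open O -> Ck r O F -> Ck r O G ->
  Ck r O (fun x => F x + G x).
Proof.
move=> oO; elim: r F G => [|r IH] F G /=.
  by move=> h1 h2 x Ox; exact: cvgD (h1 _ Ox) (h2 _ Ox).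
move=> [h1 h2] [h3 h4]; split.
  by move=> x Ox; exact: differentiableD (h1 _ Ox) (h3 _ Ox).
move=> v; apply: (@Ck_eq _ _ (fun x => 'd F x v + 'd G x v)) => //.
  by move=> x Ox; rewrite (diffD (h1 _ Ox) (h3 _ Ox)).
exact: IH.
Qed.

Lemma Ck_sum O r I (s : seq I) (P : pred I) (F : I -> 'rV[R]_m -> V) :
  open O -> (forall i, Ck r O (F i)) ->
  Ck r O (fun x => \sum_(i <- s | P i) F i x).
Proof.
move=> oO h; elim: s => [|i s IH].
  by under eq_fun do rewrite big_nil; exact: Ck_cst.
under eq_fun do rewrite big_cons; case: (P i) => //; exact: CkD.
Qed.

Lemma CkZl O r (f : 'rV[R]_m -> R) (a : V) : open O -> Ck r O f ->
  Ck r O (fun x => f x *: a).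
Proof.
move=> oO; elim: r f => [|r IH] f /=.
  by move=> h x Ox; exact: (cvgZr_tmp (h _ Ox)).
move=> [h1 h2]; split.
  by move=> x Ox; exact: differentiableZl (h1 _ Ox).
move=> v; apply: (@Ck_eq _ _ (fun x => 'd f x v *: a)) => //.
  by move=> x Ox; rewrite (diffZl _ (h1 _ Ox)).
exact: IH.
Qed.

End General.

Lemma CkM O r (f g : 'rV[R]_m -> R) : open O -> Ck r O f -> Ck r O g ->
  Ck r O (fun x => f x * g x).
Proof.
move=> oO; elim: r f g => [|r IH] f g /=.
  by move=> h1 h2 x Ox; exact: cvgM (h1 _ Ox) (h2 _ Ox).
(* The product rule brings back [f] and [g] themselves, which are used at the lower order [r]. *)
move=> /[dup] /CkW Cf [h1 h2] /[dup] /CkW Cg [h3 h4]; split.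
  by move=> x Ox; exact: differentiableM (h1 _ Ox) (h3 _ Ox).
move=> v.
apply: (@Ck_eq _ _ _ (fun x => f x * 'd g x v + g x * 'd f x v)) => //.
  move=> x Ox; apply: esym.
  exact: (congr1 (@^~ v) (diffM (h1 _ Ox) (h3 _ Ox))).
by apply: CkD oO (IH _ _ Cf (h4 v)) (IH _ _ Cg (h2 v)).
Qed.

Lemma CkV O r (f : 'rV[R]_m -> R) : open O -> (forall x, O x -> f x != 0) ->
  Ck r O f -> Ck r O (fun x => (f x)^-1).
Proof.
move=> oO f0; elim: r => [|r IH] /=.
  by move=> h x Ox; exact: cvgV (f0 _ Ox) (h _ Ox).
(* The derivative of the inverse contains the inverse itself at order [r] only, which the induction
   hypothesis provides. *)
move=> Cf; have fV := IH (CkW Cf); case: (Cf) => h1 h2; split.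
  by move=> x Ox; exact: differentiableV (h1 _ Ox) (f0 _ Ox).
move=> v.
apply: (@Ck_eq _ _ _ (fun x => -1 * ((f x)^-1 * (f x)^-1) * 'd f x v)) => //.
  move=> x Ox; rewrite mulN1r -expr2 exprVn; apply: esym.
  exact: (congr1 (@^~ v) (diffV (h1 _ Ox) (f0 _ Ox))).
exact: CkM oO (CkM oO (Ck_cst _ _ _) (CkM oO fV fV)) (h2 v).
Qed.

Lemma Ck_prod O r I (s : seq I) (P : pred I) (F : I -> 'rV[R]_m -> R) :
  open O -> (forall i, Ck r O (F i)) ->
  Ck r O (fun x => \prod_(i <- s | P i) F i x).
Proof.
move=> oO h; elim: s => [|i s IH].
  by under eq_fun do rewrite big_nil; exact: Ck_cst.
by under eq_fun do rewrite big_cons; case: (P i) => //; apply: CkM.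
Qed.

Lemma differentiable_entry a b (F : 'rV[R]_m -> 'M[R]_(a, b)) i j x v :
  differentiable F x ->
  differentiable (fun y => F y i j) x /\
  'd (fun y => F y i j) x v = 'd F x v i j.
Proof.
move=> dF; pose c (N : 'M[R]_(a, b)) : R := N i j.
have cl : linear c by move=> k M N; rewrite /c !mxE.
pose cM := GRing.isLinear.Build _ _ _ _ c cl.
pose cL : {linear 'M[R]_(a, b) -> R} := HB.pack c cM.
have cc : continuous cL by exact: coord_continuous.
have dc : differentiable cL (F x) by exact: linear_differentiable.
split; first exact: (differentiable_comp dF dc).
have dE := congr1 (@^~ v) (diff_comp dF dc).
exact: etrans dE (congr1 (@^~ ('d F x v)) (diff_lin (F x) cc)).
Qed.

Lemma Ck_entry O r a b (F : 'rV[R]_m -> 'M[R]_(a, b)) i j : open O ->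
  Ck r O F -> Ck r O (fun x => F x i j).
Proof.
move=> oO; elim: r F => [|r IH] F /=.
  move=> h x Ox.
  apply: (@continuous_comp _ _ _ F (fun N : 'M[R]_(a, b) => N i j)).
    exact: h.
  exact: coord_continuous.
move=> [h1 h2]; split.
  by move=> x Ox; case: (differentiable_entry i j 0 (h1 _ Ox)).
move=> v; apply: (@Ck_eq _ _ _ (fun x => 'd F x v i j)) => //.
  by move=> x Ox; case: (differentiable_entry i j v (h1 _ Ox)).
exact: IH.
Qed.

Lemma Ck_mx O r a b (F : 'rV[R]_m -> 'M[R]_(a, b)) : open O ->
  (forall i j, Ck r O (fun x => F x i j)) -> Ck r O F.
Proof.
move=> oO h.
apply: (@Ck_eq _ _ _ (fun x => \sum_i \sum_j F x i j *: delta_mx i j)) => //.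
  by move=> x _; rewrite -matrix_sum_delta.
by apply: Ck_sum => // i; apply: Ck_sum => // j; apply: CkZl.
Qed.

End CkCalculus.

(** Expanding ['d f (F x)] in the standard basis separates the moving point [F x] from the moving
    vector ['d F x v]; each partial derivative of [f] composed with [F] is then covered by
    induction, with [f] varying. *)
Lemma Ck_comp (R : realType) m n O O' r (F : 'rV[R]_m -> 'rV[R]_n)
    (f : 'rV[R]_n -> R) : open O -> (forall x, O x -> O' (F x)) ->
  Ck r O F -> Ck r O' f -> Ck r O (f \o F).
Proof.
move=> oO sub; elim: r f => [|r IH] f.
  move=> h1 h2 x Ox; apply: continuous_comp; first exact: h1.
  by apply: h2; exact: sub.
move=> /[dup] /CkW CF [h1 h2] [h3 h4]; split.
  by move=> x Ox; apply: differentiable_comp; [exact: h1|exact/h3/sub].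
move=> v; apply: (@Ck_eq _ _ _ _ _ (fun x =>
   \sum_j 'd F x v 0 j * 'd f (F x) (delta_mx 0 j))) => //.
  move=> x Ox.
  have dE := congr1 (@^~ v) (diff_comp (h1 _ Ox) (h3 _ (sub _ Ox))).
  apply: etrans (esym dE) => /=.
  rewrite [X in _ = 'd f _ X]matrix_sum_delta big_ord1 linear_sum.
  by apply: eq_bigr => j _; rewrite linearZ.
apply: Ck_sum => // j; apply: CkM => //; first exact: Ck_entry oO (h2 v).
exact: (IH (fun y => 'd f y (delta_mx 0 j)) CF (h4 _)).
Qed.

(** * Smoothness at a point, and matrix operations *)

Section SmoothAt.
Context {R : realType} {m : nat}.
Implicit Types (O : set 'rV[R]_m) (x v : 'rV[R]_m).

Section General.
Context {V : normedModType R}.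
Implicit Types F G : 'rV[R]_m -> V.

(** The open set can be shrunk into any neighbourhood, which allows functions smooth on different
    open sets to be combined. *)
Lemma smooth_at_within F x (N : set 'rV[R]_m) : nbhs x N -> smooth_at F x ->
  exists O, [/\ open O, O x, O `<=` N & forall r, Ck r O F].
Proof.
rewrite nbhsE => -[B [oB Bx] BN] [ O [oO Ox h]].
exists (B `&` O); split=> //.
- exact: openI.
- by move=> y [/BN].
- by move=> r; apply: Ck_sub (h r) => y [].
Qed.

Lemma smooth_at_eq F G x : (\forall y \near x, F y = G y) ->
  smooth_at F x -> smooth_at G x.
Proof.
move=> FG /(smooth_at_within FG) [ O [oO Ox sub h]].
by exists O; split=> // r; apply: Ck_eq (h r).
Qed.

Lemma smooth_at_differentiable F x : smooth_at F x -> differentiable F x.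
Proof. by move=> [ O [oO Ox /(_ 1%N) [h _]]]; exact: h. Qed.

Lemma smooth_at_continuous F x : smooth_at F x -> {for x, continuous F}.
Proof. by move=> [ O [oO Ox /(_ 0%N)]]; exact. Qed.

Lemma smooth_at_cst (a : V) x : smooth_at (fun=> a) x.
Proof. by exists setT; split=> // [|r]; [exact: openT|exact: Ck_cst]. Qed.

End General.

Lemma smooth_atM (f g : 'rV[R]_m -> R) x : smooth_at f x -> smooth_at g x ->
  smooth_at (fun y => f y * g y) x.
Proof.
move=> [ O [oO Ox h]] /(smooth_at_within (open_nbhs_nbhs (conj oO Ox))).
move=> [U [oU Ux sub h']]; exists U; split=> // r.
by apply: CkM => //; exact: Ck_sub (h r).
Qed.

Lemma smooth_atV (f : 'rV[R]_m -> R) x : smooth_at f x -> f x != 0 ->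
  smooth_at (fun y => (f y)^-1) x.
Proof.
move=> sf f0; have fn0 : \forall y \near x, f y != 0.
  exact: cvgr_neq0 (smooth_at_continuous sf) f0.
have [ O [oO Ox sub h]] := smooth_at_within fn0 sf.
by exists O; split=> // r; exact: CkV.
Qed.

Section Matrices.
Variables a b : nat.
Implicit Type F : 'rV[R]_m -> 'M[R]_(a, b).

Lemma smooth_at_entry F x i j : smooth_at F x -> smooth_at (fun y => F y i j) x.
Proof. by move=> [ O [oO Ox h]]; exists O; split=> // r; exact: Ck_entry. Qed.

(** Each entry has its own open set of smoothness; being finitely many, these still meet in a
    neighbourhood of [x]. *)
Lemma smooth_at_mx F x : (forall i j, smooth_at (fun y => F y i j) x) ->
  smooth_at F x.
Proof.
move=> h; pose N i j O := [/\ open O, O x & forall r, Ck r O (fun y => F y i j)].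
have [ O ON] : exists O : 'I_a -> 'I_b -> set 'rV[R]_m, forall i j, N i j (O i j).
  exists (fun i j => xget setT (N i j)) => i j; exact: xgetPex (h i j).
have : nbhs x [set y | forall i j, O i j y].
  apply: (@filter_forall _ _ (fun i y => forall j, O i j y) _
    (nbhs_filter x)) => i.
  apply: (@filter_forall _ _ (fun j y => O i j y) _ (nbhs_filter x)) => j.
  by have [oO Ox _] := ON i j; exact: open_nbhs_nbhs.
rewrite nbhsE => -[B [oB Bx] BO]; exists B; split=> // r.
apply: Ck_mx => // i j; have [_ _ Ckr] := ON i j; apply: Ck_sub (Ckr r).
by move=> y /BO.
Qed.

End Matrices.

Lemma smooth_at_mulmx a b c (F : 'rV[R]_m -> 'M[R]_(a, b))
    (G : 'rV[R]_m -> 'M[R]_(b, c)) x :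
  smooth_at F x -> smooth_at G x -> smooth_at (fun y => F y *m G y) x.
Proof.
move=> [ O [oO Ox h]] /(smooth_at_within (open_nbhs_nbhs (conj oO Ox))).
move=> [U [oU Ux sub h']]; exists U; split=> // r.
apply: Ck_mx => // i j; under eq_fun do rewrite mxE.
apply: Ck_sum => // l; apply: CkM => //; last exact: Ck_entry.
by apply: Ck_entry => //; exact: Ck_sub (h r).
Qed.

Lemma smooth_at_col_mx a b c (F : 'rV[R]_m -> 'M[R]_(a, c))
    (G : 'rV[R]_m -> 'M[R]_(b, c)) x :
  smooth_at F x -> smooth_at G x -> smooth_at (fun y => col_mx (F y) (G y)) x.
Proof.
move=> sF sG; apply: smooth_at_mx => i j.
by case: (split_ordP i) => i' ->; under eq_fun do rewrite ?col_mxEu ?col_mxEd;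
  apply: smooth_at_entry.
Qed.

Lemma smooth_at_trmx a b (F : 'rV[R]_m -> 'M[R]_(a, b)) x :
  smooth_at F x -> smooth_at (fun y => (F y)^T) x.
Proof.
move=> sF; apply: smooth_at_mx => i j; under eq_fun do rewrite mxE.
exact: smooth_at_entry.
Qed.

Lemma smooth_at_row_mx a b c (F : 'rV[R]_m -> 'M[R]_(c, a))
    (G : 'rV[R]_m -> 'M[R]_(c, b)) x :
  smooth_at F x -> smooth_at G x -> smooth_at (fun y => row_mx (F y) (G y)) x.
Proof.
move=> sF sG; apply: smooth_at_mx => i j.
by case: (split_ordP j) => j' ->; under eq_fun do rewrite ?row_mxEl ?row_mxEr;
  apply: smooth_at_entry.
Qed.

Lemma smooth_at_det a (F : 'rV[R]_m -> 'M[R]_a) x :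
  smooth_at F x -> smooth_at (fun y => \det (F y)) x.
Proof.
move=> [ O [oO Ox h]]; exists O; split=> // r; rewrite /determinant.
apply: Ck_sum => // s; apply: CkM => //; first exact: Ck_cst.
by apply: Ck_prod => // i; exact: Ck_entry.
Qed.

Lemma near_unitmx a (F : 'rV[R]_m -> 'M[R]_a) x :
  smooth_at F x -> F x \in unitmx -> \forall y \near x, F y \in unitmx.
Proof.
rewrite unitmxE unitfE => /smooth_at_det /smooth_at_continuous cF F0.
have : \forall y \near x, \det (F y) != 0.
  exact: cvgr_neq0 cF F0.
by apply: filterS => y; rewrite unitmxE unitfE.
Qed.

(** Cramer's rule: at invertible matrices, which persist near [x], the inverse is the adjugate over
    the determinant. *)
Lemma smooth_at_invmx a (F : 'rV[R]_m -> 'M[R]_a) x :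
  smooth_at F x -> F x \in unitmx -> smooth_at (fun y => invmx (F y)) x.
Proof.
move=> sF uF.
apply: (@smooth_at_eq _ (fun y => (\det (F y))^-1%:M *m \adj (F y))).
  apply: filterS (near_unitmx sF uF) => y uy.
  by rewrite /invmx uy mul_scalar_mx.
apply: smooth_at_mulmx.
  apply: smooth_at_mx => i j; under eq_fun do rewrite mxE.
  case: (i == j) => /=; last first.
    by under eq_fun do rewrite mulr0n; exact: smooth_at_cst.
  by apply: smooth_atV; [exact: smooth_at_det|rewrite -unitfE -unitmxE].
apply: smooth_at_mx => i j; under eq_fun do rewrite mxE.
apply: smooth_atM; first exact: smooth_at_cst.
apply: smooth_at_det; apply: smooth_at_mx => k' l'.
by under eq_fun do rewrite !mxE; exact: smooth_at_entry.
Qed.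

End SmoothAt.

(** * Composition and Jacobian matrices *)

Section Jacobian.
Context {R : realType}.

Lemma smooth_at_comp m n a b (F : 'rV[R]_m -> 'rV[R]_n)
    (G : 'rV[R]_n -> 'M[R]_(a, b)) x :
  smooth_at F x -> smooth_at G (F x) -> smooth_at (G \o F) x.
Proof.
move=> sF [U [oU Ux h']].
have Fn : \forall y \near x, U (F y).
  exact: smooth_at_continuous sF _ (open_nbhs_nbhs (conj oU Ux)).
have [ O [oO Ox sub h]] := smooth_at_within Fn sF; exists O; split=> // r.
apply: Ck_mx => // i j; apply: (@Ck_comp _ _ _ _ U _ _ (fun y => G y i j)) => //.
exact: Ck_entry.
Qed.

Lemma smooth_at_jacobian m n (F : 'rV[R]_m -> 'rV[R]_n) x :
  smooth_at F x -> smooth_at (fun y => 'J F y) x.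
Proof.
move=> [ O [oO Ox h]]; exists O; split=> // r; apply: Ck_mx => // i j.
under eq_fun do rewrite mxE; apply: Ck_entry => //.
by have [_] := h r.+1; exact.
Qed.

Lemma smooth_at_row_mulmx m n (A : 'M[R]_(m, n)) x :
  smooth_at (fun y : 'rV[R]_m => y *m A) x.
Proof.
apply: smooth_at_mulmx; last exact: smooth_at_cst.
exists setT; split=> // [|[|r]]; first exact: openT.
  by move=> y _; exact: cvg_id.
split=> [y _|v]; first exact: ex_diff.
apply: (@Ck_eq _ _ _ _ _ (fun=> v) _ openT) (Ck_cst _ _ _) => y _.
by rewrite diff_val.
Qed.

(** Tangent vectors are rows, so the Jacobian of the map applied first stands on the left. *)
Lemma jacobian_comp m n p (F : 'rV[R]_m -> 'rV[R]_n)
    (G : 'rV[R]_n -> 'rV[R]_p) x :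
  differentiable F x -> differentiable G (F x) ->
  'J (G \o F) x = 'J F x *m 'J G (F x).
Proof.
move=> dF dG; apply/row_matrixP => i; rewrite !rowE mulmxA !mul_rV_lin1 /=.
exact: (congr1 (@^~ _) (diff_comp dF dG)).
Qed.

Lemma near_eq_jacobian m n (F G : 'rV[R]_m -> 'rV[R]_n) x :
  (\forall y \near x, F y = G y) -> differentiable F x -> 'J G x = 'J F x.
Proof.
move=> FG /(near_eq_differentiable FG) [_ e].
exact: (congr1 (fun h => lin1_mx h) e).
Qed.

Lemma jacobian_mulmx m n (A : 'M[R]_(m, n)) x :
  'J (fun y : 'rV[R]_m => y *m A) x = A.
Proof.
pose f := mulmxr A : {linear 'rV[R]_m -> 'rV[R]_n}.
have cf : continuous f.
  by move=> y; exact: (smooth_at_continuous (smooth_at_row_mulmx A y)).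
apply/row_matrixP => i; rewrite !rowE !mul_rV_lin1 /=.
exact: (congr1 (@^~ _) (diff_lin x cf)).
Qed.

End Jacobian.

(** * Charts *)

Section Charts.
Context {R : realType} {m : nat} {M : charted R m}.
Implicit Types (phi psi chi : chart R m M) (p q : M).

Lemma coordK phi p q : is_chart phi -> dom phi q -> coord phi p (phi q) = q.
Proof.
move=> [_ inj _ _] dq; rewrite /Defs.coord; case: xgetP => [q' _ [dq' e]|].
  by apply: inj; rewrite ?inE.
by move=> /(_ q) /(_ (conj dq erefl)).
Qed.

Lemma near_dom phi q : is_chart phi -> dom phi q ->
  \forall q' \near q, dom phi q'.
Proof. by move=> [od _ _ _] dq; exact: open_nbhs_nbhs. Qed.

Lemma near_chart phi q (P : 'rV[R]_m -> Prop) : is_chart phi -> dom phi q ->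
  (\forall x \near phi q, P x) -> \forall q' \near q, P (phi q').
Proof. by move=> [_ _ c _] /c h Px; exact: h Px. Qed.

(** Charts are open maps: all coordinates near [phi q] come from points near [q], where
    [coord phi p] is the true inverse. Local properties of the manifold thus become local properties
    in coordinates. *)
Lemma near_coord phi p q (P : M -> Prop) : is_chart phi -> dom phi q ->
  (\forall q' \near q, P q') ->
  \forall x \near phi q, exists q', [/\ dom phi q', phi q' = x,
    coord phi p x = q' & P q'].
Proof.
move=> cphi dq; have [od inj _ im] := cphi.
rewrite /prop_near1 nbhsE => -[B [oB Bq] BP].
have : nbhs (phi q) (phi @` (B `&` dom phi)).
  apply: open_nbhs_nbhs; split; last by exists q.
  by apply: im; [exact: openI|move=> x []].
apply: filterS => _ [q' [/BP Pq' dq'] <-]; exists q'; split=> //.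
exact: coordK.
Qed.

Hypothesis hM : is_manifold M.

Lemma atlas_chart phi : atlas phi -> is_chart phi.
Proof. by case: hM => _ _ _ + _; exact. Qed.

Lemma chart_at_atlas p : atlas (chart_at p).
Proof. by case: hM => _ _ /(_ p) []. Qed.

Lemma chart_at_dom p : dom (chart_at p) p.
Proof. by case: hM => _ _ /(_ p) []. Qed.

Lemma smooth_transition phi psi p q : atlas phi -> atlas psi ->
  dom phi q -> dom psi q -> smooth_at (psi \o coord phi p) (phi q).
Proof.
move=> aphi apsi dphi dpsi; case: hM => _ _ _ _ /(_ _ _ _ aphi apsi dphi dpsi).
apply: smooth_at_eq; have cphi := atlas_chart aphi.
apply: filterS (near_coord q cphi dphi (near_dom cphi dphi)).
by move=> _ [q' [dq' <- _ _]] /=; rewrite !coordK.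
Qed.

(* [coord phi p] depends on [p] only through its junk values. *)
Lemma tcoord_base phi psi p q : atlas phi -> atlas psi ->
  dom phi q -> dom psi q -> 'J (psi \o coord phi p) (phi q) = tcoord phi psi q.
Proof.
move=> aphi apsi dphi dpsi; apply: near_eq_jacobian; last first.
  exact/smooth_at_differentiable/smooth_transition.
have cphi := atlas_chart aphi.
apply: filterS (near_coord q cphi dphi (near_dom cphi dphi)).
by move=> _ [q' [dq' <- _ _]] /=; rewrite !coordK.
Qed.

(** Chain rule for transition maps: the intermediate chart cancels near [phi q]. *)
Lemma tcoord_comp phi psi chi q : atlas phi -> atlas psi -> atlas chi ->
  dom phi q -> dom psi q -> dom chi q ->
  tcoord phi psi q *m tcoord psi chi q = tcoord phi chi q.
Proof.
move=> aphi apsi achi dphi dpsi dchi.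
have cphi := atlas_chart aphi; have cpsi := atlas_chart apsi.
have eq : psi q = (psi \o coord phi q) (phi q) by rewrite /= coordK.
have d1 := smooth_at_differentiable (smooth_transition q aphi apsi dphi dpsi).
have d2 : differentiable (chi \o coord psi q) ((psi \o coord phi q) (phi q)).
  by rewrite -eq; exact/smooth_at_differentiable/smooth_transition.
have := jacobian_comp d1 d2; rewrite -eq => <-.
apply/esym/near_eq_jacobian; last by apply: differentiable_comp.
apply: filterS (near_coord q cphi dphi (near_dom cpsi dpsi)).
by move=> _ [q' [dq' <- _ dq'']] /=; rewrite !coordK.
Qed.

Lemma tcoord_id phi q : atlas phi -> dom phi q -> tcoord phi phi q = 1%:M.
Proof.
move=> aphi dphi; rewrite -(jacobian_mulmx 1%:M (phi q)).
have cphi := atlas_chart aphi.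
apply: near_eq_jacobian; last first.
  exact/smooth_at_differentiable/smooth_at_row_mulmx.
apply: filterS (near_coord q cphi dphi (near_dom cphi dphi)).
by move=> _ [q' [dq' <- _ _]] /=; rewrite !coordK// mulmx1.
Qed.

Lemma tcoordK phi psi q : atlas phi -> atlas psi -> dom phi q -> dom psi q ->
  tcoord phi psi q *m tcoord psi phi q = 1%:M.
Proof. by move=> *; rewrite tcoord_comp// tcoord_id. Qed.

Lemma tcoord_unit phi psi q : atlas phi -> atlas psi -> dom phi q ->
  dom psi q -> tcoord phi psi q \in unitmx.
Proof.
move=> a1 a2 d1 d2; exact: (mulmx1_unit (tcoordK a1 a2 d1 d2)).1.
Qed.

(** Read in [chi], the coordinate change is the Jacobian of the transition from [phi] to [psi],
    evaluated along the transition from [chi] to [phi]. *)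
Lemma smooth_tcoord chi phi psi p : atlas chi -> atlas phi -> atlas psi ->
  dom chi p -> dom phi p -> dom psi p ->
  smooth_at (fun x => tcoord phi psi (coord chi p x)) (chi p).
Proof.
move=> achi aphi apsi dchi dphi dpsi.
have cchi := atlas_chart achi; have cphi := atlas_chart aphi.
have cpsi := atlas_chart apsi.
apply: (@smooth_at_eq _ _ _
    ((fun y => 'J (psi \o coord phi p) y) \o (phi \o coord chi p))); last first.
  apply: smooth_at_comp; first exact: smooth_transition.
  by rewrite /= coordK//; exact/smooth_at_jacobian/smooth_transition.
apply: filterS (near_coord p cchi dchi
  (filterI (near_dom cphi dphi) (near_dom cpsi dpsi))).
move=> x [q [dq xq cq [dq1 dq2]]] /=.
rewrite cq; exact: (tcoord_base p aphi apsi dq1 dq2).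
Qed.

Lemma continuous_tcoord phi psi p : atlas phi -> atlas psi ->
  dom phi p -> dom psi p -> {for p, continuous (tcoord phi psi)}.
Proof.
move=> aphi apsi dphi dpsi.
have cphi := atlas_chart aphi; have [_ _ cc _] := cphi.
have := smooth_at_continuous (smooth_tcoord aphi aphi apsi dphi dphi dpsi).
rewrite /prop_for /continuous_at coordK// => ct.
apply: cvg_trans (cvg_comp _ _ (cc _ dphi) ct); apply: near_eq_cvg.
apply: filterS (near_dom cphi dphi) => q dq /=.
by rewrite coordK.
Qed.

End Charts.

(** * Maps between manifolds read in arbitrary charts *)

Section MapsInCharts.
Context {R : realType} {s m : nat} {S : charted R s} {M : charted R m}.
Hypotheses (hS : is_manifold S) (hM : is_manifold M).
Variable u : S -> M.
Hypothesis su : smooth_map u.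
Variables (phi : chart R s S) (psi : chart R m M) (p : S).
Hypotheses (aphi : atlas phi) (apsi : atlas psi).
Hypotheses (dphi : dom phi p) (dpsi : dom psi (u p)).

(** Near [phi p], the map [u] read in [phi] and [psi] factors as [pre], then [map_in u p], then
    [post]. *)
Let pre := chart_at p \o coord phi p.
Let post := psi \o coord (chart_at (u p)) (u p).

Let near_factor p0 : \forall x \near phi p,
  (post \o map_in u p \o pre) x = (psi \o u \o coord phi p0) x.
Proof.
have cphi := atlas_chart hS aphi.
have cp := atlas_chart hS (chart_at_atlas hS p).
have cup := atlas_chart hM (chart_at_atlas hM (u p)).
have nu : \forall q \near p, dom (chart_at (u p)) (u q).
  exact: su.1 p _ (near_dom cup (chart_at_dom hM _)).
apply: filterS (near_coord p cphi dphi
  (filterI (near_dom cp (chart_at_dom hS p)) nu)).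
move=> _ [q [dq <- _ [dq1 dq2]]].
by rewrite /post /map_in /pre /= !coordK.
Qed.

Let smooth_pre : smooth_at pre (phi p).
Proof.
exact: (smooth_transition hS p aphi (chart_at_atlas hS p) dphi
  (chart_at_dom hS p)).
Qed.

Let pre_p : pre (phi p) = chart_at p p.
Proof. by rewrite /pre /= coordK//; exact: atlas_chart. Qed.

Let map_p : map_in u p (chart_at p p) = chart_at (u p) (u p).
Proof.
rewrite /map_in /= coordK//; last exact: chart_at_dom.
exact/(atlas_chart hS)/(chart_at_atlas hS).
Qed.

Let smooth_post : smooth_at post (chart_at (u p) (u p)).
Proof.
exact: (smooth_transition hM _ (chart_at_atlas hM _) apsi
  (chart_at_dom hM _) dpsi).
Qed.

Lemma smooth_in_charts p0 : smooth_at (psi \o u \o coord phi p0) (phi p).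
Proof.
apply: (smooth_at_eq (near_factor p0)).
apply: (smooth_at_comp smooth_pre); rewrite pre_p; apply: smooth_at_comp.
  by case: su => _; exact.
by rewrite map_p.
Qed.

Lemma jacobian_in_charts p0 : 'J (psi \o u \o coord phi p0) (phi p) =
  tcoord phi (chart_at p) p *m mdiff u p *m tcoord (chart_at (u p)) psi (u p).
Proof.
have d1 := smooth_at_differentiable smooth_pre.
have d2 : differentiable (map_in u p) (pre (phi p)).
  by rewrite pre_p; apply: smooth_at_differentiable; case: su => _; exact.
have d3 : differentiable post ((map_in u p \o pre) (phi p)).
  by rewrite /= pre_p map_p; exact: smooth_at_differentiable.
have d12 := differentiable_comp d1 d2.
rewrite (near_eq_jacobian (near_factor p0) (differentiable_comp d12 d3)).
rewrite (jacobian_comp d12 d3) (jacobian_comp d1 d2) /= pre_p map_p.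
rewrite (tcoord_base hM _ (chart_at_atlas hM _)) ?(tcoord_base hS _ aphi)//.
- exact: chart_at_atlas.
- exact: chart_at_dom.
- exact: chart_at_dom.
Qed.

End MapsInCharts.

(** A local frame of [D] is smooth when read in the preferred chart at [p]; a transition Jacobian,
    smooth as well, carries it to [phi]. *)
Lemma frame_in_chart (R : realType) (m : nat) (M : charted R m)
    (D : M -> 'M[R]_m) r (phi : chart R m M) (p : M) :
  is_manifold M -> Defs.distribution D r -> atlas phi -> dom phi p ->
  exists2 Y : 'rV[R]_m -> 'M[R]_(r, m), smooth_at Y (phi p) &
    \forall q \near p, (Y (phi q) :=: D q *m tcoord (chart_at q) phi q)%MS.
Proof.
move=> hM [_ /(_ p) [ O [X [oO Op sX XD]]]] aphi dphi.
have cphi := atlas_chart hM aphi; have ap := chart_at_atlas hM p.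
have dp := chart_at_dom hM p; have cp := atlas_chart hM ap.
exists (fun x => vect_in X p (chart_at p (coord phi p x)) *m
                 tcoord (chart_at p) phi (coord phi p x)).
  apply: smooth_at_mulmx; last exact: smooth_tcoord.
  apply: (@smooth_at_comp _ _ _ _ _ (chart_at p \o coord phi p)).
    exact: smooth_transition.
  by rewrite /= coordK//; exact: sX.
apply: filterS (filterI (open_nbhs_nbhs (conj oO Op))
  (filterI (near_dom cphi dphi) (near_dom cp dp))) => q [Oq [dq1 dq2]].
have aq := chart_at_atlas hM q; have dq := chart_at_dom hM q.
rewrite (coordK p cphi dq1) /vect_in (coordK p cp dq2) -mulmxA.
rewrite (tcoord_comp hM aq ap aphi dq dq2 dq1).
exact/eqmxMr/eqmxP/XD.
Qed.

(** * Spaces of hyperplanes *)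

Section RowSpaces.
Context {F : fieldType}.

Lemma notin_rowspace a m (A : 'M[F]_(a, m)) (w : 'rV[F]_m) (b : 'cV[F]_m) :
  A *m b = 0 -> w *m b != 0 -> ~~ (w <= A)%MS.
Proof.
by move=> Ab; apply: contraNN => /submxP[B ->]; rewrite -mulmxA Ab mulmx0.
Qed.

Lemma mxrank_adds_row a m (A : 'M[F]_(a, m)) (w : 'rV[F]_m) :
  ~~ (w <= A)%MS -> \rank (A + w)%MS = (\rank A).+1.
Proof.
move=> wA; have w0 : w != 0 by apply: contraNneq wA => ->; exact: sub0mx.
rewrite mxrank_disjoint_sum ?rank_rV ?w0 ?addn1//; apply/eqP.
(* The intersection with [A] is a proper subspace of the line spanned by [w]. *)
rewrite -mxrank_eq0 -leqn0 -ltnS; apply: leq_trans (_ : \rank w <= 1)%N.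
  rewrite (ltn_leqif (mxrank_leqif_sup (capmxSr _ _))).
  by rewrite sub_capmx submx_refl andbT.
by rewrite rank_rV; case: (w != 0).
Qed.

Lemma row_base_of_rank a m b (A : 'M[F]_(a, m)) : \rank A = b ->
  exists B : 'M[F]_(b, m), (B :=: A)%MS.
Proof. by move=> <-; exists (row_base A); exact: eq_row_base. Qed.

Lemma adds_mulmx0 a b m (A : 'M[F]_(a, m)) (B : 'M[F]_(b, m)) (v : 'cV[F]_m) :
  (A + B)%MS *m v = 0 <-> A *m v = 0 /\ B *m v = 0.
Proof.
split=> [/sub_kermxP|[/sub_kermxP Av /sub_kermxP Bv]].
  by rewrite addsmx_sub => /andP[/sub_kermxP ? /sub_kermxP].
by apply/sub_kermxP; rewrite addsmx_sub Av.
Qed.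

Lemma sub_mulmx0 a b m (A : 'M[F]_(a, m)) (B : 'M[F]_(b, m)) (v : 'cV[F]_m) :
  (A <= B)%MS -> B *m v = 0 -> A *m v = 0.
Proof. by move=> /submxP[C ->] Bv; rewrite -mulmxA Bv mulmx0. Qed.

Lemma scalar_mx1E (A : 'M[F]_1) : A = (A 0 0)%:M.
Proof. by apply/matrixP => i j; rewrite !ord1 mxE eqxx. Qed.

End RowSpaces.

(** A left inverse of [F x] turns full rank into invertibility of a square matrix, an open
    condition. *)
Lemma near_row_full (R : realType) m a b (F : 'rV[R]_m -> 'M[R]_(a, b)) x :
  smooth_at F x -> row_full (F x) -> \forall y \near x, row_full (F y).
Proof.
move=> sF /row_fullP[L LF].
have : \forall y \near x, L *m F y \in unitmx.
  apply: near_unitmx; last by rewrite LF unitmx1.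
  by apply: smooth_at_mulmx => //; exact: smooth_at_cst.
apply: filterS => y u; apply/row_fullP; exists (invmx (L *m F y) *m L).
by rewrite -mulmxA mulVmx.
Qed.

(** * Charts of the space of hyperplanes, for a group [G] of nonzero scalars covering both
    contactisations *)

Section HypSpace.
Context {R : realType} {m : nat} {M : charted R m}.
Variables (r k : nat) (G : set R) (D : M -> 'M[R]_m).
Hypotheses (hM : is_manifold M) (hD : distribution D r) (mE : m = (r + k)%N).
Hypotheses (G1 : G 1) (G0 : forall c, G c -> c != 0)
  (Gdiv : forall c d, G c -> G d -> G (c / d)).
Implicit Types (q : hyp_space k G D) (phi : chart R m M) (w : 'rV[R]_m)
  (W : 'M[R]_(k.-1, m)).

Let GM c d : G c -> G d -> G (c * d).
Proof.
by move=> Gc Gd; rewrite -[d]invrK -[d^-1]mul1r; apply/Gdiv/Gdiv.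
Qed.

Lemma ray_inh q : exists a, ray q a.
Proof.
by have [a [_ _ ->]] := rayP q; exists a; exists 1; rewrite ?scale1r.
Qed.

Lemma ray_neq0 q a : ray q a -> a != 0.
Proof.
have [b [b0 _ ->]] := rayP q => -[c Gc <-].
by rewrite scaler_eq0 negb_or b0 G0.
Qed.

Lemma ray_annihilates q a : ray q a -> D (foot q) *m a = 0.
Proof.
have [b [_ Db ->]] := rayP q => -[c Gc <-].
by rewrite -scalemxAr Db scaler0.
Qed.

Lemma ray_eq q a : ray q a -> ray q = [set c *: a | c in G].
Proof.
have [b [_ _ ->]] := rayP q => -[d Gd <-]; apply/seteqP; split=> _ [c Gc <-].
  by exists (c / d); [exact: Gdiv|rewrite scalerA divfK// G0].
by exists (c * d); [exact: GM|rewrite scalerA].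
Qed.

(** In corank zero only the zero covector annihilates [D]. Positivity makes [k.-1 + 1 = k] in
    dimension counts. *)
Lemma corank_gt0 q : (0 < k)%N.
Proof.
have [a qa] := ray_inh q; rewrite lt0n; apply: contra (ray_neq0 qa) => /eqP k0.
have : row_full (D (foot q)).
  by rewrite /row_full (proj1 hD) [X in _ == X]mE k0 addn0.
move=> /row_fullP[L LD]; rewrite -[a]mul1mx -LD -mulmxA ray_annihilates//.
by rewrite mulmx0.
Qed.

Lemma hyp_dom_exists phi q : atlas phi -> dom phi (foot q) ->
  exists wW, hyp_dom phi wW.1 wW.2 q.
Proof.
move=> aphi dphi; have [a qa] := ray_inh q; have a0 := ray_neq0 qa.
have [i ai] : exists i, a i 0 != 0.
  apply/existsP; apply: contraNT a0; rewrite negb_exists => /forallP h.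
  apply/eqP/matrixP => i j; rewrite ord1 mxE; apply/eqP.
  by have := h i; rewrite negbK.
(* A basis vector on which [a] is nonzero, scaled so that [a] takes the value 1; the values on the
   ray are then the elements of [G]. *)
pose w0 : 'rV[R]_m := (a i 0)^-1 *: delta_mx 0 i.
have w0a : w0 *m a = 1%:M.
  rewrite -scalemxAl -rowE; apply/matrixP => x y; rewrite !ord1 !mxE eqxx.
  by rewrite mulVf.
have w0D : ~~ (w0 <= D (foot q))%MS.
  apply: notin_rowspace (ray_annihilates qa) _; rewrite w0a.
  by apply/eqP => /matrixP/(_ 0 0)/eqP; rewrite !mxE eqxx oner_eq0.
(* A basis of a complement of [D + w0], of dimension [m - (r + 1) = k - 1]. *)
have [W0 W0E] : exists B : 'M[R]_(k.-1, m), (B :=: (D (foot q) + w0)^C)%MS.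
  apply: row_base_of_rank; rewrite mxrank_compl mxrank_adds_row// (proj1 hD).
  by rewrite [in LHS]mE subnS addKn.
have dq := chart_at_dom hM (foot q); have aq := chart_at_atlas hM (foot q).
exists (w0 *m tcoord (chart_at (foot q)) phi (foot q),
        W0 *m tcoord (chart_at (foot q)) phi (foot q)).
rewrite /hyp_dom /= -!mulmxA (tcoordK hM aq aphi dq dphi) !mulmx1; split=> //.
  have := addsmx_compl_full (D (foot q) + w0)%MS; rewrite -!sub1mx.
  by move=> /submx_trans; apply; apply: addsmxS; rewrite ?W0E.
move=> b; rewrite (ray_eq qa) => -[c Gc <-].
by rewrite -scalemxAr w0a !mxE mulr1.
Qed.

(** Numerator and denominator scale by the same factor, so any representative may replace the one
    picked by [xget]. *)
Lemma hyp_coordE phi w W q a : ray q a ->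
  let J := tcoord phi (chart_at (foot q)) (foot q) in
  hyp_coord phi w W q = row_mx (phi (foot q))
    (((w *m J *m a) 0 0)^-1 *: (W *m J *m a)^T).
Proof.
move=> qa J; rewrite /hyp_coord -/J; set b := xget 0 (ray q).
have : ray q b by apply: (xgetPex 0 (P := ray q)); exists a.
rewrite (ray_eq qa) => -[c Gc <-]; congr row_mx.
rewrite -!scalemxAr [X in X^-1]mxE linearZ scalerA invfM mulrAC.
by rewrite mulVf ?mul1r// G0.
Qed.

(** This trades [D p], whose matrix need not vary continuously, for a smooth frame in coordinates,
    to which openness of full rank applies. The two sides differ by the invertible [J]. *)
Lemma hyp_row_full phi w W p (Y : 'rV[R]_m -> 'M[R]_(r, m)) :
  atlas phi -> dom phi p -> (Y (phi p) :=: D p *m tcoord (chart_at p) phi p)%MS ->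
  let J := tcoord phi (chart_at p) p in
  row_full (D p + w *m J + W *m J)%MS =
  row_full (col_mx (Y (phi p)) (col_mx w W)).
Proof.
move=> aphi dphi YE J.
have dp := chart_at_dom hM p; have ap := chart_at_atlas hM p.
rewrite /row_full; congr (_ == _).
have JU : row_free J by rewrite row_free_unit tcoord_unit.
rewrite -(mxrankMfree (col_mx _ _) JU); apply: eqmx_rank; apply/eqmxP.
have colM a b (A : 'M[R]_(a, m)) (B : 'M[R]_(b, m)) :
    (col_mx A B *m J :=: A *m J + B *m J)%MS.
  by rewrite mul_col_mx; exact: eqmx_sym (addsmxE _ _).
apply: eqmx_sym; apply: eqmx_trans (colM _ _ _ _) _.
rewrite -addsmxA; apply: adds_eqmx (colM _ _ _ _).
apply: eqmx_trans (eqmxMr _ YE) _.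
by rewrite -mulmxA (tcoordK hM ap aphi dp dphi) mulmx1.
Qed.

Lemma near_hyp_row_full phi w W p : atlas phi -> dom phi p ->
  let J p' := tcoord phi (chart_at p') p' in
  row_full (D p + w *m J p + W *m J p)%MS ->
  \forall p' \near p, row_full (D p' + w *m J p' + W *m J p')%MS.
Proof.
move=> aphi dphi J; have [Y sY YE] := frame_in_chart hM hD aphi dphi.
have cphi := atlas_chart hM aphi.
move=> /(etrans (esym (hyp_row_full w W aphi dphi (nbhs_singleton YE)))) full.
have sN : smooth_at (fun y => col_mx (Y y) (col_mx w W)) (phi p).
  by apply: smooth_at_col_mx => //; exact: smooth_at_cst.
have := near_chart cphi dphi (near_row_full sN full).
apply: filterS3 YE (near_dom cphi dphi) => p' YE' dp'.
exact: etrans (hyp_row_full w W aphi dp' YE').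
Qed.

(* The hyperplane over [y] with fibre coordinates [z] is the kernel of the
   covector [a] with [D a = 0], [w a = 1] and [W a = z]. *)
Lemma hyp_coord_surj phi w W q : atlas phi -> hyp_dom phi w W q ->
  \forall x \near hyp_coord phi w W q,
    exists2 q' : hyp_space k G D, hyp_dom phi w W q' & hyp_coord phi w W q' = x.
Proof.
move=> aphi [dphi full _]; have [Y sY YE] := frame_in_chart hM hD aphi dphi.
(* [P] gathers the open conditions on the foot; it constrains only the first [m] coordinates and
   leaves those of the fibre free. *)
have cphi := atlas_chart hM aphi; have k0 := corank_gt0 q.
pose P y := exists p, [/\ dom phi p, phi p = y,
    row_full (D p + w *m tcoord phi (chart_at p) p +
              W *m tcoord phi (chart_at p) p)%MS &
    (Y (phi p) :=: D p *m tcoord (chart_at p) phi p)%MS].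
have nP : nbhs (lsubmx (hyp_coord phi w W q)) P.
  rewrite row_mxKl; apply: filterS (near_coord (foot q) cphi dphi
    (filterI (near_hyp_row_full aphi dphi full) YE)).
  by move=> x [p [? ? _ []]]; exists p.
have nlP : \forall x \near hyp_coord phi w W q, P (lsubmx x).
  exact: (@continuous_lsubmx R 1 m k.-1 (hyp_coord phi w W q) _ nP).
apply: filterS nlP => x [p [dp px]].
set J := tcoord phi _ p; set J' := tcoord _ phi p => fullp YEp.
pose N := col_mx (Y (phi p)) (col_mx w W).
have Nfull : row_full N := etrans (esym (hyp_row_full w W aphi dp YEp)) fullp.
(* [N] has [r + 1 + (k - 1) = m] rows, hence is square. *)
have Nfree : row_free N.
  rewrite /row_free (eqP Nfull) [X in X == _]mE add1n prednK//.
have JJ' : J *m J' = 1%:M.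
  exact: (tcoordK hM aphi (chart_at_atlas hM _) dp (chart_at_dom hM _)).
have J'J : J' *m J = 1%:M by exact: mulmx1C.
pose al := pinvmx N *m col_mx 0 (col_mx 1%:M (rsubmx x)^T) : 'cV[R]_m.
have : N *m al = col_mx 0 (col_mx 1%:M (rsubmx x)^T).
  by rewrite /al mulmxA mulmxVp// mul1mx.
rewrite !mul_col_mx => /eq_col_mx[Yal /eq_col_mx[wal Wal]].
pose a := J' *m al; have Ja : J *m a = al by rewrite mulmxA JJ' mul1mx.
have Da : annihilates D p a.
  by rewrite /annihilates mulmxA; apply: sub_mulmx0 Yal; rewrite YEp.
have a0 : a != 0.
  apply/eqP => a0; move: Ja wal; rewrite a0 mulmx0 => <-; rewrite mulmx0.
  by move=> /matrixP/(_ 0 0)/eqP; rewrite !mxE eqxx eq_sym oner_eq0.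
have rP : exists b, [/\ b != 0, annihilates D p b &
    [set c *: a | c in G] = [set c *: b | c in G]] by exists a.
pose q' := HypSpace k rP.
have qa : ray q' a by exists 1; rewrite ?scale1r.
exists q'.
  split=> // b; rewrite (ray_eq qa) => -[c Gc <-] /=.
  by rewrite -mulmxA -scalemxAr Ja -scalemxAr wal !mxE mulr1.
rewrite (hyp_coordE _ _ _ qa) /= -!mulmxA Ja wal Wal mxE invr1 scale1r.
by rewrite trmxK px hsubmxK.
Qed.

End HypSpace.

Lemma near_comp (T U : topologicalType) (g : T -> U) x (P : U -> Prop) :
  {for x, continuous g} -> (\forall y \near g x, P y) -> \forall z \near x, P (g z).
Proof. by move=> cg; apply: cg. Qed.

(** * Topology of the space of hyperplanes and its projection *)

Section HypManifold.
Context {R : realType} {m : nat} {M : charted R m}.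
Variables (r k : nat) (G : set R) (D : M -> 'M[R]_m).
Hypotheses (hM : is_manifold M) (hD : distribution D r) (mE : m = (r + k)%N).
Hypotheses (G1 : G 1) (G0 : forall c, G c -> c != 0)
  (Gdiv : forall c d, G c -> G d -> G (c / d)).
Local Notation hyp := (hyp_manifold k G D).
Local Notation proj := (@hyp_proj R m M k G D).
Implicit Types (phi : chart R m M) (w : 'rV[R]_m) (W : 'M[R]_(k.-1, m)).

Lemma open_hyp_subbase (A : set hyp) : hyp_subbase A -> open A.
Proof.
move=> sA; exists [set A]; last by rewrite bigcup_set1.
by move=> _ ->; exact: (@finI_from1 _ _ _ id).
Qed.

(** Every neighbourhood contains a finite intersection of subbasic sets around [q], and a filter is
    stable under such intersections. *)
Lemma cvg_hyp_subbase (T : Type) (F : set_system T) (g : T -> hyp) (q : hyp) :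
  Filter F -> (forall A : set hyp, hyp_subbase A -> A q -> F (g @^-1` A)) ->
  g @ F --> q.
Proof.
move=> FF h A; rewrite nbhsE => -[B [oB Bq] BA].
case: oB Bq BA => U sU <- [C UC Cq] sub.
have FgF : Filter (g @ F) by exact: fmap_filter.
apply: (@filterS _ (g @ F) FgF C) => [t Ct|]; first by apply: sub; exists C.
have [E sE CE] := sU _ UC; rewrite -CE.
apply: (@filter_bigI _ _ _ _ (g @ F) FgF) => A' EA'; apply: h.
  by have /set_mem := sE _ EA'.
by move: Cq; rewrite -CE => /(_ _ EA').
Qed.

Lemma hyp_chart_atE (q : hyp) : exists w W,
  hyp_dom (chart_at (proj q)) w W (q : hyp_space k G D) /\
  chart_at q = hyp_chart G D (chart_at (proj q)) w W.
Proof.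
have ex := hyp_dom_exists hM hD mE G1 G0 Gdiv
  (chart_at_atlas hM (proj q)) (chart_at_dom hM _).
pose P := [set wW | hyp_dom (chart_at (proj q)) wW.1 wW.2 (q : hyp_space k G D)].
pose wW := xget (0, 0) P.
by exists wW.1, wW.2; split=> //; exact: (xgetPex (0, 0) (P := P)).
Qed.

(** By [hyp_coord_surj], all [x] near the coordinates of [q] are in the image of the chart;
    whichever preimage [coord] picks, its foot has the first [m] entries of [x] as coordinates. *)
Lemma map_in_hyp_proj (q : hyp) : \forall x \near chart_at q q,
  x *m col_mx 1%:M 0 = map_in proj q x.
Proof.
have [w [W [dq cE]]] := hyp_chart_atE q; rewrite /map_in cE.
have := hyp_coord_surj hM hD mE G1 G0 Gdiv (chart_at_atlas hM (proj q)) dq.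
apply: filterS => x [q' dq' xE] /=.
rewrite -[x in LHS]hsubmxK mul_row_col mulmx1 mulmx0 addr0.
rewrite /Defs.coord; set A := [set _ | _].
have [_ /= {1}<-] : A (xget q A) by apply: (xgetPex q (P := A)); exists q'.
by rewrite row_mxKl.
Qed.

Lemma mdiff_hyp_proj (q : hyp) : mdiff proj q = col_mx 1%:M 0.
Proof.
rewrite /mdiff (near_eq_jacobian (map_in_hyp_proj q)) ?jacobian_mulmx//.
exact/smooth_at_differentiable/smooth_at_row_mulmx.
Qed.

Lemma continuous_hyp_proj : continuous proj.
Proof.
move=> q A; rewrite nbhsE => -[B [oB Bq] BA].
have [w [W [dq cE]]] := hyp_chart_atE q.
set phi := chart_at (proj q) in dq cE.
have aphi : atlas phi := chart_at_atlas hM _.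
have [od inj _ im] := atlas_chart hM aphi.
(* A condition on the foot coordinates alone cuts out a subbasic set inside the preimage. *)
pose O : set 'rV[R]_(m + k.-1) := lsubmx @^-1` (phi @` (B `&` dom phi)).
have oO : open O.
  apply: open_comp; first by move=> x _; exact: continuous_lsubmx.
  by apply: im; [exact: openI|move=> x []].
pose c := hyp_chart G D phi w W.
have sub : hyp_subbase (dom c `&` c @^-1` O).
  by exists c, O; split=> //; exists phi, w, W.
apply: (@filterS _ (nbhs q) _ (dom c `&` c @^-1` O)).
  move=> q' [[dq' _ _] [p [Bp dp]]] /=; rewrite row_mxKl => e.
  have pE : p = proj q' by apply: inj; rewrite ?inE.
  by apply: BA; rewrite -pE.
apply: open_nbhs_nbhs; split; first exact: open_hyp_subbase.
split=> //; exists (proj q); last by rewrite /= row_mxKl.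
by split=> //; exact: chart_at_dom.
Qed.

(** * Regularity of maps into the space of hyperplanes *)

Section Lift.
Context {s : nat} {S : charted R s}.
Hypothesis hS : is_manifold S.
Variable f : S -> hyp.
Local Notation u := (proj \o f).
Local Notation rayf p := (ray (f p : hyp_space k G D)).

Lemma mdiff_foot p : smooth_map f -> mdiff u p = mdiff f p *m mdiff proj (f p).
Proof.
move=> [_ /(_ p) sf]; have d1 := smooth_at_differentiable sf.
have d2 : differentiable
    (fun x : 'rV[R]_(m + k.-1) => x *m col_mx 1%:M 0 : 'rV[R]_m)
    (map_in f p (chart_at p p)).
  exact/smooth_at_differentiable/smooth_at_row_mulmx.
have := jacobian_comp d1 d2; rewrite jacobian_mulmx mdiff_hyp_proj => <-.
(* The preferred chart at [f p] is built on the one at its foot, so reading [u] amounts to dropping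
   the fibre coordinates of [f]. *)
congr jacobian; apply/funext => x /=.
have [w [W [_ cE]]] := hyp_chart_atE (f p).
by rewrite /map_in cE /= mul_row_col mulmx1 mulmx0 addr0.
Qed.

(** Vanishing on [D] is part of being a hyperplane containing it; vanishing on the image of [du] is
    tangency to [xi_can], since [du] factors through the projection. Uniqueness of lifts rests on
    this. *)
Lemma isotropic_annihilates p a : isotropic_immersion f -> rayf p a ->
  pre_hyp D u p *m a = 0.
Proof.
move=> [[sf _] iso] ra; apply/adds_mulmx0; split; last exact: ray_annihilates ra.
apply/row_matrixP => i; rewrite row_mul rowE row0 mdiff_foot// mulmxA.
exact: iso.
Qed.

Hypothesis pu : preisotropic D u.
Hypothesis fu : forall p a, rayf p a -> pre_hyp D u p *m a = 0.

Let su : smooth_map u. Proof. by case: pu => [[]]. Qed.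

(* [b] is the representative of [f p] with [w b = 1], read in the chart [phi];
   it solves the linear system given by a frame of [D], the Jacobian of [u]
   and [w]. *)
Lemma local_covector p0 phi w : atlas phi -> dom phi (u p0) ->
  let J p := tcoord phi (chart_at (u p)) (u p) in
  (forall a, rayf p0 a -> (w *m J p0 *m a) 0 0 != 0) ->
  exists2 b : 'rV[R]_s -> 'cV[R]_m, smooth_at b (chart_at p0 p0) &
    \forall p \near p0, dom phi (u p) /\ forall a, rayf p a ->
      (w *m J p *m a) 0 0 != 0 /\
      J p *m a = (w *m J p *m a) 0 0 *: b (chart_at p0 p).
Proof.
move=> aphi dphi J wJ; set chi := chart_at p0.
have achi : atlas chi := chart_at_atlas hS p0.
have dchi : dom chi p0 := chart_at_dom hS p0.
have cchi := atlas_chart hS achi; have cphi := atlas_chart hM aphi.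
have [Y sY YE] := frame_in_chart hM hD aphi dphi.
pose ut := phi \o u \o coord chi p0.
have sut : smooth_at ut (chi p0) by exact: smooth_in_charts.
have utE p : dom chi p -> ut (chi p) = phi (u p).
  by move=> dp; rewrite /ut /= coordK.
pose K x := col_mx (Y (ut x)) ('J ut x).
have sK : smooth_at K (chi p0).
  apply: smooth_at_col_mx; last exact: smooth_at_jacobian.
  by apply: (smooth_at_comp sut); rewrite utE.
pose J' p := tcoord (chart_at (u p)) phi (u p).
(* In [phi], the rows of [K] span [H_p]: the Jacobian of [ut] is [mdiff u p] up to invertible
   coordinate changes. *)
have KE p : dom chi p -> dom phi (u p) ->
    (Y (phi (u p)) :=: D (u p) *m J' p)%MS ->
    (K (chi p) :=: pre_hyp D u p *m J' p)%MS.
  move=> dp dup YEp; rewrite /K utE//.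
  have -> : 'J ut (chi p) = tcoord chi (chart_at p) p *m mdiff u p *m J' p.
    exact: jacobian_in_charts.
  apply: eqmx_trans (eqmx_sym (addsmxE _ _)) _; rewrite /pre_hyp.
  apply: eqmx_trans (eqmx_sym (addsmxMr _ _ _)).
  rewrite addsmxC; apply: adds_eqmx YEp; rewrite -mulmxA.
  apply: eqmxMfull; rewrite row_full_unit tcoord_unit//.
  - exact: chart_at_atlas.
  - exact: chart_at_dom.
have J'J p : dom phi (u p) -> J' p *m J p = 1%:M.
  move=> dp.
  exact: (tcoordK hM (chart_at_atlas hM _) aphi (chart_at_dom hM _) dp).
have Ka p a : dom chi p -> dom phi (u p) ->
    (Y (phi (u p)) :=: D (u p) *m J' p)%MS -> rayf p a ->
    K (chi p) *m (J p *m a) = 0.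
  move=> dp dup YEp ra; apply: (@sub_mulmx0 _ _ _ _ _ (pre_hyp D u p *m J' p)).
    by rewrite KE.
  by rewrite -mulmxA (mulmxA (J' p)) (J'J p dup) mul1mx (fu ra).
have YE0 := nbhs_singleton YE.
have full : row_full (col_mx (K (chi p0)) w).
  have [a ra] := ray_inh G1 (f p0 : hyp_space k G D).
  rewrite /row_full -addsmxE mxrank_adds_row.
    rewrite KE// mxrankMfree ?(proj2 pu p0)// row_free_unit tcoord_unit//.
    - exact: chart_at_atlas.
    - exact: chart_at_dom.
  apply: (notin_rowspace (Ka _ _ dchi dphi YE0 ra)); rewrite mulmxA.
  by apply: contraNneq (wJ _ ra) => ->; rewrite mxE.
(* The left inverse at [p0], kept fixed, reduces the possibly overdetermined system to a square one
   that stays invertible near [p0]. *)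
have [L LE] := row_fullP full.
pose B x := L *m col_mx (K x) w.
have sB : smooth_at B (chi p0).
  apply: smooth_at_mulmx; first exact: smooth_at_cst.
  by apply: smooth_at_col_mx sK _; exact: smooth_at_cst.
have uB : B (chi p0) \in unitmx by rewrite /B LE unitmx1.
exists (fun x => invmx (B x) *m (L *m col_mx 0 1%:M)).
  apply: smooth_at_mulmx; first exact: smooth_at_invmx.
  exact: smooth_at_cst.
have nB := near_chart cchi dchi (near_unitmx sB uB).
pose P q := dom phi q /\ (Y (phi q) :=: D q *m tcoord (chart_at q) phi q)%MS.
have nP : \forall q \near u p0, P q by exact: (filterI (near_dom cphi dphi) YE).
apply: filterS3 nB (near_comp (su.1 p0) nP) (near_dom cchi dchi).
move=> p uBp [dup YEp] dp.
split=> // a ra; set c := (w *m J p *m a) 0 0.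
have Jb : J p *m a = c *: (invmx (B (chi p)) *m (L *m col_mx 0 1%:M)).
  rewrite -[LHS](mulKmx uBp) [X in _ *m X](_ : _ = c *: (L *m col_mx 0 1%:M)).
    by rewrite -scalemxAr.
  (* Only the last equation, that of [w], has a nonzero right-hand side, namely [c]. *)
  rewrite /B -mulmxA mul_col_mx Ka// mulmxA [w *m _ *m _]scalar_mx1E -/c.
  by rewrite scalemxAr scale_col_mx scaler0 scalemx1.
split=> //; apply: contraNneq (ray_neq0 G0 ra) => c0.
have := congr1 (mulmx (J' p)) Jb.
by rewrite c0 scale0r [RHS]mulmx0 [LHS]mulmxA (J'J p dup) mul1mx => ->.
Qed.

(** The factor [w a] cancels in the fibre coordinates, leaving the smooth [W b]. *)
Lemma hyp_coord_lift p0 phi w W : atlas phi -> dom phi (u p0) ->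
  let J p := tcoord phi (chart_at (u p)) (u p) in
  (forall a, rayf p0 a -> (w *m J p0 *m a) 0 0 != 0) ->
  exists2 g : 'rV[R]_s -> 'rV[R]_(m + k.-1), smooth_at g (chart_at p0 p0) &
    \forall p \near p0,
      hyp_coord phi w W (f p : hyp_space k G D) = g (chart_at p0 p).
Proof.
move=> aphi dphi J wJ; have [b sb nb] := local_covector aphi dphi wJ.
have dp0 := chart_at_dom hS p0; have ap0 := chart_at_atlas hS p0.
exists (fun x => row_mx ((phi \o u \o coord (chart_at p0) p0) x) (W *m b x)^T).
  apply: smooth_at_row_mx; first exact: smooth_in_charts.
  by apply/smooth_at_trmx/smooth_at_mulmx => //; exact: smooth_at_cst.
have cp0 := atlas_chart hS ap0.
apply: filterS2 nb (near_dom cp0 dp0) => p [_ bE] dp.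
have [a ra] := ray_inh G1 (f p : hyp_space k G D); have [c0 ae] := bE _ ra.
rewrite (hyp_coordE G1 G0 Gdiv _ _ _ ra) /= coordK//; congr row_mx.
by rewrite -[W *m _ *m a]mulmxA ae -scalemxAr linearZ scalerA mulVf// scale1r.
Qed.

(** Openness, along [f], of the condition on [w] in a chart domain. For nonzero scalars
    [local_covector] gives it; for positive ones it comes from continuity of the co-orientation. *)
Hypothesis fG : forall p0 phi w, atlas phi -> dom phi (u p0) ->
  let J p := tcoord phi (chart_at (u p)) (u p) in
  (forall a, rayf p0 a -> G ((w *m J p0 *m a) 0 0)) ->
  \forall p \near p0, forall a, rayf p a -> G ((w *m J p *m a) 0 0).

Lemma continuous_lift : continuous f.
Proof.
move=> p0; apply: cvg_hyp_subbase.
move=> _ [_ [U [[phi [w [W [aphi ->]]]] oU ->]]] [[dphi full wG] /= Uf].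
have [g sg gE] := hyp_coord_lift W aphi dphi (fun a ra => G0 (wG a ra)).
have nd : \forall p \near p0, dom phi (u p).
  exact: (near_comp (su.1 p0) (near_dom (atlas_chart hM aphi) dphi)).
have nfull : \forall p \near p0, row_full (D (u p) +
    w *m tcoord phi (chart_at (u p)) (u p) +
    W *m tcoord phi (chart_at (u p)) (u p))%MS.
  exact: (near_comp (su.1 p0) (near_hyp_row_full hM hD aphi dphi full)).
have cp0 := atlas_chart hS (chart_at_atlas hS p0).
have dp0 := chart_at_dom hS p0.
have nU : \forall x \near chart_at p0 p0, U (g x).
  apply: (near_comp (smooth_at_continuous sg)); apply: open_nbhs_nbhs.
  by split=> //; rewrite -(nbhs_singleton gE).
have ng := near_chart cp0 dp0 nU.
apply: filterS3 (filterI gE ng) (filterI nd nfull) (fG aphi dphi wG).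
move=> p [gEp Ug] [dp fp] Gp; split; first by split.
by rewrite /= gEp.
Qed.

Lemma smooth_lift : smooth_map f.
Proof.
split=> [|p0]; first exact: continuous_lift.
have [w [W [[dphi _ wG] cE]]] := hyp_chart_atE (f p0).
have aphi := chart_at_atlas hM (proj (f p0)).
have [g sg gE] := hyp_coord_lift W aphi dphi (fun a ra => G0 (wG a ra)).
apply: smooth_at_eq sg; rewrite /map_in cE.
have cp0 := atlas_chart hS (chart_at_atlas hS p0).
apply: filterS (near_coord p0 cp0 (chart_at_dom hS p0) gE).
by move=> x [p [_ <- /= -> <-]].
Qed.

(** As [du] is the differential of [f] followed by that of the projection, the rank of the former
    bounds the rank of the differential of [f] from below; tangency is vanishing of the covectors on
    the image of [du]. *)
Lemma isotropic_immersion_lift : isotropic_immersion f.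
Proof.
have sf := smooth_lift; split; first split=> // p.
  have [[_ /(_ p) rf] _] := pu.
  move: rf; rewrite mdiff_foot// /row_free => /eqP rk.
  by rewrite eqn_leq rank_leq_row -{1}rk mxrankM_maxl.
move=> p v a ra; rewrite -(mulmxA v) -mdiff_foot// -mulmxA.
by have /adds_mulmx0[-> _] := fu ra; rewrite mulmx0.
Qed.

End Lift.

(** An open set of [S] is the preimage under the composite of some open [U'], hence the preimage
    under [f] of the open set over [U']. *)
Lemma embedding_lift s (S : charted R s) (f : S -> hyp) :
  immersion f -> embedding (proj \o f) -> embedding f.
Proof.
move=> immf [_ inj emb]; split=> //; first exact: inj_compr inj.
move=> U /emb[U' oU' ->]; exists (proj @^-1` U') => //.
by apply: open_comp => // q _; exact: continuous_hyp_proj.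
Qed.

End HypManifold.

(** * Lifts of preisotropic immersions *)

Section Corank1.
Context {F : fieldType} {a m : nat} {H : 'M[F]_(a, m)}.
Hypothesis rH : (\rank H).+1 = m.

(** Otherwise [H] and [v] would span everything and [b] would vanish. *)
Lemma sub_corank1 (b : 'cV[F]_m) (v : 'rV[F]_m) :
  b != 0 -> H *m b = 0 -> v *m b = 0 -> (v <= H)%MS.
Proof.
move=> b0 Hb vb; apply: contraNT b0 => vH.
have /row_fullP[L LE] : row_full (H + v)%MS.
  by rewrite /row_full mxrank_adds_row// [X in X == _]rH.
apply/eqP; rewrite -[b]mul1mx -LE -mulmxA.
have -> : (H + v)%MS *m b = 0 by apply/adds_mulmx0.
exact: mulmx0.
Qed.

(** Annihilating covectors are the transposes of the kernel of [H^T], which has rank one. *)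
Lemma corank1_annihilator : exists2 b : 'cV[F]_m, b != 0 /\ H *m b = 0 &
  forall c : 'cV[F]_m, H *m c = 0 -> exists x, c = x *: b.
Proof.
have rK : \rank (kermx H^T) = 1.
  by rewrite mxrank_ker mxrank_tr -{1}rH subSnn.
have [v vE] := row_base_of_rank rK; exists v^T.
  split; last first.
    apply: trmx_inj; rewrite trmx_mul trmxK trmx0; apply/sub_kermxP.
    by rewrite vE.
  apply/eqP => /(congr1 trmx); rewrite trmxK trmx0 => v0.
  by move: rK; rewrite -vE v0 mxrank0.
move=> c Hc; have : (c^T <= v)%MS.
  by rewrite vE; apply/sub_kermxP; rewrite -trmx_mul Hc trmx0.
by move=> /sub_rVP[x cE]; exists x; rewrite -[c]trmxK cE linearZ.
Qed.

End Corank1.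

Lemma cvg_sumr (R : realType) (T I : Type) (F : set_system T) (t : seq I)
    (h : I -> T -> R) (l : I -> R) : Filter F ->
  (forall i, h i x @[x --> F] --> l i) ->
  \sum_(i <- t) h i x @[x --> F] --> \sum_(i <- t) l i.
Proof.
move=> FF hl; elim: t => [|i t IH].
  rewrite big_nil [X in X @ _](_ : _ = fun=> 0); first exact: cvg_cst.
  by apply/funext => x; rewrite big_nil.
rewrite big_cons [X in X @ _](_ : _ = fun x => h i x + \sum_(i <- t) h i x).
  exact: (cvgD (hl i) IH).
by apply/funext => x; rewrite big_cons.
Qed.

(** Stated entrywise and for any filter, to be used for matrix functions on the manifold [S]. *)
Lemma cvg_mulmx_entry (R : realType) (T : Type) (F : set_system T) a b c
    (f : T -> 'M[R]_(a, b)) (g : T -> 'M[R]_(b, c)) (A : 'M[R]_(a, b))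
    (B : 'M[R]_(b, c)) : Filter F ->
  (forall i j, f x i j @[x --> F] --> A i j) ->
  (forall i j, g x i j @[x --> F] --> B i j) ->
  forall i j, (f x *m g x) i j @[x --> F] --> (A *m B) i j.
Proof.
move=> FF fA gB i j; under eq_fun do rewrite mxE; rewrite mxE.
by apply: cvg_sumr => l; exact: cvgM.
Qed.

Lemma cvg_entry (R : realType) (T : Type) (F : set_system T) a b
    (f : T -> 'M[R]_(a, b)) (A : 'M[R]_(a, b)) i j : Filter F ->
  f x @[x --> F] --> A -> f x i j @[x --> F] --> A i j.
Proof.
move=> FF fA.
exact: (cvg_comp f (fun N : 'M[R]_(a, b) => N i j) fA
          (@coord_continuous R a b i j A)).
Qed.

Lemma mulmxZ00 (R : comPzRingType) m (v : 'rV[R]_m) (b : 'cV[R]_m) (x : R) :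
  (v *m (x *: b)) 0 0 = x * (v *m b) 0 0.
Proof. by rewrite -scalemxAr mxE. Qed.

Lemma Rpos1 (R : realType) : Rpos (1 : R).
Proof. exact: ltr01. Qed.

Lemma Rpos_neq0 (R : realType) (c : R) : Rpos c -> c != 0.
Proof. exact: lt0r_neq0. Qed.

Lemma Rpos_div (R : realType) (c d : R) : Rpos c -> Rpos d -> Rpos (c / d).
Proof. exact: divr_gt0. Qed.

Lemma Rnz1 (R : realType) : Rnz (1 : R).
Proof. exact: oner_neq0. Qed.

Lemma Rnz_neq0 (R : realType) (c : R) : Rnz c -> c != 0.
Proof. by []. Qed.

Lemma Rnz_div (R : realType) (c d : R) : Rnz c -> Rnz d -> Rnz (c / d).
Proof. by move=> c0 d0; rewrite /Rnz /= mulf_neq0 ?invr_neq0. Qed.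

Lemma hyp_space_eq (R : realType) m (M : charted R m) k G D
    (q q' : @hyp_space R m M k G D) :
  foot q = foot q' -> ray q = ray q' -> q = q'.
Proof.
case: q q' => [p A AP] [p' A' AP'] /= pE AE; subst p' A'.
by congr HypSpace; exact: Prop_irrelevance.
Qed.

(** * Existence and uniqueness of the two lifts *)

Section Main.
Context {R : realType} {m : nat} {M : charted R m}.
Variables (r k : nat) (D : M -> 'M[R]_m).
Hypotheses (hM : is_manifold M) (hD : distribution D r) (mE : m = (r + k)%N).
Context {s : nat} {S : charted R s}.
Hypothesis hS : is_manifold S.

(* A local section [X] of [co] pairs with the representative normalised by [w]
   to a continuous function, positive at [p0] and hence near [p0]. *)
Lemma near_cooriented (f : S -> contactisation k D) (co : S -> set 'rV[R]_m) :
  let u := @hyp_proj _ _ _ _ _ _ \o f in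
  preisotropic D u -> coorientation D u co ->
  (forall p a, ray (f p : hyp_space k Rpos D) a -> pre_hyp D u p *m a = 0) ->
  (forall p a, ray (f p : hyp_space k Rpos D) a ->
     co p = [set v | 0 < (v *m a) 0 0]) ->
  forall p0 (phi : chart R m M) (w : 'rV[R]_m), atlas phi -> dom phi (u p0) ->
  let J p := tcoord phi (chart_at (u p)) (u p) in
  (forall a, ray (f p0 : hyp_space k Rpos D) a -> Rpos ((w *m J p0 *m a) 0 0)) ->
  \forall p \near p0, forall a, ray (f p : hyp_space k Rpos D) a ->
    Rpos ((w *m J p *m a) 0 0).
Proof.
move=> u pu cco fu fco p0 phi w aphi dphi J wG.
have [b sb nb] := local_covector hM hD (@Rpos1 R) (@Rpos_neq0 R) hS pu fu aphi
  dphi (fun a ra => Rpos_neq0 (wG a ra)).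
have [_ /(_ p0) [U [X [oU Up Xco Xc]]]] := cco.
have achi := chart_at_atlas hS p0; have dchi := chart_at_dom hS p0.
have cchi := atlas_chart hS achi.
have apsi := chart_at_atlas hM (u p0); have dpsi := chart_at_dom hM (u p0).
have cpsi := atlas_chart hM apsi.
(* The pairing passes through the preferred chart at [u p0], the one in which the section [X] is
   known to be continuous at [p0]. *)
pose h p := X p *m tcoord (chart_at (u p)) (chart_at (u p0)) (u p) *m
  (tcoord (chart_at (u p0)) phi (u p) *m b (chart_at p0 p)).
have cu : {for p0, continuous u} by case: pu => [[[cu _] _] _]; exact: cu.
have hc : h p 0 0 @[p --> p0] --> h p0 0 0.
  apply: cvg_mulmx_entry; first by move=> i j; apply: cvg_entry; exact: (Xc _ Up).
  apply: cvg_mulmx_entry => i j; apply: cvg_entry.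
    exact: (cvg_comp u (tcoord (chart_at (u p0)) phi) cu
              (continuous_tcoord hM apsi aphi dpsi dphi)).
  have [_ _ cc _] := cchi.
  exact: (cvg_comp (chart_at p0) b (cc _ dchi) (smooth_at_continuous sb)).
(* Coordinate changes cancel, so [X a] is [w a] times [h]: the signs of [X a] and [h] determine that
   of [w a]. *)
have hE p a : dom (chart_at (u p0)) (u p) -> dom phi (u p) ->
    J p *m a = (w *m J p *m a) 0 0 *: b (chart_at p0 p) ->
    (X p *m a) 0 0 = (w *m J p *m a) 0 0 * h p 0 0.
  move=> d1 d2 Ja; set c := (w *m J p *m a) 0 0 in Ja *.
  have ap := chart_at_atlas hM (u p); have dp := chart_at_dom hM (u p).
  have <- : (c *: h p) 0 0 = c * h p 0 0 by rewrite mxE.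
  congr (fun_of_matrix _ 0 0).
  rewrite /h -mulmxA scalemxAr scalemxAr scalemxAr -Ja.
  rewrite [_ *m (_ *m (J p *m a))]mulmxA (tcoord_comp hM ap apsi aphi dp d1 d2).
  by rewrite mulmxA (tcoordK hM ap aphi dp d2) mul1mx.
have h0 : 0 < h p0 0 0.
  have [a ra] := ray_inh (@Rpos1 R) (f p0 : hyp_space k Rpos D).
  have [_ /(_ _ ra) [_ Ja]] := nbhs_singleton nb.
  have := Xco _ Up; rewrite (fco _ _ ra) /= (hE _ _ dpsi dphi Ja).
  by rewrite pmulr_rgt0//; exact: wG.
have nh := cvgr_gt _ hc _ h0.
have nU : \forall p \near p0, U p by exact: open_nbhs_nbhs.
have npsi : \forall p \near p0, dom (chart_at (u p0)) (u p).
  exact: (near_comp cu (near_dom cpsi dpsi)).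
near=> p => a ra.
have [dp bE] : dom phi (u p) /\ forall a, ray (f p : hyp_space k Rpos D) a ->
    (w *m J p *m a) 0 0 != 0 /\
    J p *m a = (w *m J p *m a) 0 0 *: b (chart_at p0 p) by near: p.
have hp : 0 < h p 0 0 by near: p; exact: nh.
have Upp : U p by near: p.
have dpp : dom (chart_at (u p0)) (u p) by near: p.
(* [X p] is positive for the co-orientation and [h p] is positive by continuity, so the remaining
   factor is positive. *)
have [_ Ja] := bE _ ra; have := Xco _ Upp.
by rewrite (fco _ _ ra) /= (hE _ _ dpp dp Ja) pmulr_lgt0.
Unshelve. all: by end_near. Qed.

(** A purely pointwise construction; smoothness comes later from [isotropic_immersion_lift]. *)
Lemma hyp_map_exists (G : set R) (u : S -> M) (al : S -> 'cV[R]_m) :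
  (forall p, al p != 0 /\ pre_hyp D u p *m al p = 0) ->
  exists2 f : S -> hyp_manifold k G D, @hyp_proj _ _ _ _ _ _ \o f = u &
    forall p, ray (f p : hyp_space k G D) = [set c *: al p | c in G].
Proof.
move=> al0.
have rP p : exists a, [/\ a != 0, annihilates D (u p) a &
    [set c *: al p | c in G] = [set c *: a | c in G]].
  by exists (al p); have [? /adds_mulmx0[]] := al0 p.
by exists (fun p => HypSpace k (rP p)).
Qed.

Lemma isotropic_lift_unique (u : S -> M) : preisotropic D u ->
  exists! uh : S -> pcontactisation k D, isotropic_lift u uh.
Proof.
move=> pu; pose P p (b : 'cV[R]_m) := (b != 0 /\ pre_hyp D u p *m b = 0) /\
  forall c : 'cV[R]_m, pre_hyp D u p *m c = 0 -> exists x, c = x *: b.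
have /choice[al alP] : forall p, exists b, P p b.
  by move=> p; have [b b0 bE] := corank1_annihilator (pu.2 p); exists b.
have [uh uhE uhr] := hyp_map_exists Rnz (fun p => (alP p).1).
have uh_ann p a : ray (uh p : hyp_space k Rnz D) a -> pre_hyp D u p *m a = 0.
  by rewrite uhr => -[c _ <-]; rewrite -scalemxAr (alP p).1.2 scaler0.
exists uh; split=> [|uh' [iuh' uhE']].
  split=> //; subst u.
  apply: (isotropic_immersion_lift hM hD mE (@Rnz1 R) (@Rnz_neq0 R)
    (@Rnz_div R) hS pu uh_ann) => p0 phi w aphi dphi J wJ.
  (* For nonzero scalars the chart condition is [w a != 0], which [local_covector] propagates. *)
  have [b _] := local_covector hM hD (@Rnz1 R) (@Rnz_neq0 R) hS pu uh_ann aphi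
    dphi wJ.
  by apply: filterS => p [_ bE] a /bE[].
apply/funext => p; apply: hyp_space_eq.
  by rewrite -[LHS]/((@hyp_proj _ _ _ _ _ _ \o uh) p) uhE -uhE'.
(* Any representative of the other lift annihilates [H_p], hence is a nonzero multiple of [al p]. *)
have [a ra] := ray_inh (@Rnz1 R) (uh' p : hyp_space k Rnz D).
have := isotropic_annihilates hM hD mE (@Rnz1 R) (@Rnz_neq0 R) (@Rnz_div R)
  iuh' ra.
rewrite uhE' => /(alP p).2[x ax].
rewrite (ray_eq (@Rnz1 R) (@Rnz_neq0 R) (@Rnz_div R) ra).
apply: (ray_eq (@Rnz1 R) (@Rnz_neq0 R) (@Rnz_div R)); rewrite uhr.
exists x => //; apply/negP => /eqP x0.
by have := ray_neq0 (@Rnz_neq0 R) ra; rewrite ax x0 scale0r eqxx.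
Qed.

(** A generator of the annihilator of [H_p], scaled to be 1 on a positive vector [v], is positive
    exactly on the positive side. *)
Lemma cooriented_annihilator (u : S -> M) (co : S -> set 'rV[R]_m) p :
  preisotropic D u -> coorientation D u co ->
  exists b : 'cV[R]_m, [/\ b != 0, pre_hyp D u p *m b = 0 &
    co p = [set v | 0 < (v *m b) 0 0]].
Proof.
move=> pu [/(_ p) [v vH coE] _]; set H := pre_hyp D u p in vH coE *.
have rH : (\rank H).+1 = m := pu.2 p.
have [b [b0 Hb] _] := corank1_annihilator rH.
have vb : (v *m b) 0 0 != 0.
  apply: contraNneq vH => vb0; apply: (sub_corank1 rH b0 Hb).
  by rewrite [v *m b]scalar_mx1E vb0 raddf0.
pose a := ((v *m b) 0 0)^-1 *: b.
have Ha : H *m a = 0 by rewrite -scalemxAr Hb scaler0.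
have a0 : a != 0 by rewrite scaler_eq0 negb_or b0 invr_neq0.
have va : (v *m a) 0 0 = 1 by rewrite -scalemxAr mxE mulVf.
have hH (h : 'rV[R]_m) : (h <= H)%MS -> h *m a = 0.
  by move=> hH; exact: sub_mulmx0 hH Ha.
exists a; split=> //; rewrite coE; apply/seteqP; split=> x /=.
  move=> [c c0 [h /= /hH ha <-]].
  by rewrite mulmxDl ha addr0 -scalemxAl mxE va mulr1.
move=> xa; exists ((x *m a) 0 0) => //.
(* The component of [x] along [H_p] in the splitting by [v]; [a] kills it because [a] is 1 on
   [v]. *)
exists (x - (x *m a) 0 0 *: v) => /=; last by rewrite addrC subrK.
apply: (sub_corank1 rH a0 Ha); rewrite mulmxBl -scalemxAl.
by rewrite [v *m a]scalar_mx1E va scalemx1 -scalar_mx1E subrr.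
Qed.

Lemma cooriented_isotropic_lift_unique (u : S -> M)
    (uh : S -> pcontactisation k D) (co : S -> set 'rV[R]_m) :
  preisotropic D u -> isotropic_lift u uh -> coorientation D u co ->
  exists! ut : S -> contactisation k D, cooriented_isotropic_lift u co uh ut.
Proof.
move=> pu [iuh uhE] cco.
have /choice[al alP] := fun p => cooriented_annihilator p pu cco.
have al0 p : al p != 0 /\ pre_hyp D u p *m al p = 0 by have [] := alP p.
have alco p : co p = [set v | 0 < (v *m al p) 0 0] by have [] := alP p.
(* Both covectors are nonzero and lie on the annihilator line of [H_p], so their orbits agree. *)
have uh_al p : ray (uh p : hyp_space k Rnz D) = [set c *: al p | c in Rnz].
  have [a ra] := ray_inh (@Rnz1 R) (uh p : hyp_space k Rnz D).
  have := isotropic_annihilates hM hD mE (@Rnz1 R) (@Rnz_neq0 R) (@Rnz_div R)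
    iuh ra.
  have [b [b0 Hb] bE] := corank1_annihilator (pu.2 p).
  rewrite uhE => /bE[x ax]; have [y aly] := bE _ (al0 p).2.
  have a0 := ray_neq0 (@Rnz_neq0 R) ra.
  have x0 : x != 0 by apply: contraNneq a0 => x0; rewrite ax x0 scale0r.
  have y0 : y != 0 by apply: contraNneq (al0 p).1 => y0; rewrite aly y0 scale0r.
  apply: (ray_eq (@Rnz1 R) (@Rnz_neq0 R) (@Rnz_div R)).
  rewrite (ray_eq (@Rnz1 R) (@Rnz_neq0 R) (@Rnz_div R) ra); exists (y / x).
    exact: Rnz_div.
  by rewrite ax aly scalerA divfK.
have [ut utE utr] := hyp_map_exists Rpos al0.
have ut_ann p a : ray (ut p : hyp_space k Rpos D) a -> pre_hyp D u p *m a = 0.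
  by rewrite utr => -[c _ <-]; rewrite -scalemxAr (al0 p).2 scaler0.
have ut_co p a : ray (ut p : hyp_space k Rpos D) a ->
    co p = [set v | 0 < (v *m a) 0 0].
  rewrite utr alco => -[c c0 <-]; apply/seteqP.
  by split=> v /=; rewrite mulmxZ00 pmulr_rgt0.
exists ut; split=> [|ut' [iut' dcE' utE' ut_co']].
  split; last exact: ut_co; last exact: utE.
    move: pu cco ut_ann; rewrite -utE => pu' cco' ut_ann'.
    apply: (isotropic_immersion_lift hM hD mE (@Rpos1 R) (@Rpos_neq0 R)
      (@Rpos_div R) hS pu' ut_ann').
    exact: (near_cooriented pu' cco' ut_ann' ut_co).
  apply/funext => p; apply: hyp_space_eq.
    by rewrite -[LHS]/((@hyp_proj _ _ _ _ _ _ \o ut) p) utE -uhE.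
  rewrite uh_al; apply: (ray_eq (@Rnz1 R) (@Rnz_neq0 R) (@Rnz_div R)).
  exists 1; first exact: Rnz1.
  exists (al p); last exact: scale1r.
  by rewrite utr; exists 1; [exact: Rpos1|exact: scale1r].
apply/funext => p; apply: hyp_space_eq.
  by rewrite -[LHS]/((@hyp_proj _ _ _ _ _ _ \o ut) p) utE -utE'.
have [a ra] := ray_inh (@Rpos1 R) (ut' p : hyp_space k Rpos D).
have dE : double_cover (ut' p) = uh p by rewrite -dcE'.
have : ray (double_cover (ut' p) : hyp_space k Rnz D) a.
  by exists 1; [exact: Rnz1|exists a; rewrite ?scale1r].
rewrite dE uh_al => -[c c0 ac].
(* [a = c al] with [c] nonzero; both covectors are positive on a positive vector [v], which forces
   [c] to be positive. *)
have [v _ coE] := cco.1 p.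
have vco : co p v.
  rewrite coE; exists 1; first exact: Rpos1.
  by exists 0; rewrite ?scale1r ?addr0 //=; exact: sub0mx.
have va : 0 < (v *m a) 0 0 by move: vco; rewrite (ut_co' _ _ ra).
have val : 0 < (v *m al p) 0 0 by move: vco; rewrite alco.
rewrite (ray_eq (@Rpos1 R) (@Rpos_neq0 R) (@Rpos_div R) ra).
apply: (ray_eq (@Rpos1 R) (@Rpos_neq0 R) (@Rpos_div R)); rewrite utr.
by exists c => //; move: va; rewrite -ac mulmxZ00 pmulr_lgt0.
Qed.

End Main.

Theorem proposition2p13 (R : realType) (n k : nat)
    (M : charted R (n.*2 + k)) (D : M -> 'M[R]_(n.*2 + k))
    (hM : fat_manifold D n.*2)
    (s : nat) (S : charted R s) (hS : is_manifold S)
    (u : S -> M) (hu : preisotropic D u) :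
  (exists! uh : S -> pcontactisation k D, isotropic_lift u uh) /\
  (forall (uh : S -> pcontactisation k D) (co : S -> set 'rV[R]_(n.*2 + k)),
     isotropic_lift u uh -> coorientation D u co ->
     exists! ut : S -> contactisation k D,
       cooriented_isotropic_lift u co uh ut) /\
  (embedding u ->
     (forall uh : S -> pcontactisation k D,
        isotropic_lift u uh -> embedding uh) /\
     (forall (uh : S -> pcontactisation k D) (co : S -> set 'rV[R]_(n.*2 + k))
             (ut : S -> contactisation k D),
        isotropic_lift u uh -> coorientation D u co ->
        cooriented_isotropic_lift u co uh ut -> embedding ut)).
Proof.
case: hM => mM dD _.
split; first exact: (isotropic_lift_unique mM dD erefl hS hu).
split=> [uh co|eu].
  exact: (cooriented_isotropic_lift_unique mM dD erefl hS hu).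
split=> [uh [[iuh _] uE]|uh co ut _ _ [[iut _] _ uE _]].
  apply: (embedding_lift mM dD erefl (@Rnz1 R) (@Rnz_neq0 R) (@Rnz_div R) iuh).
  by rewrite uE.
apply: (embedding_lift mM dD erefl (@Rpos1 R) (@Rpos_neq0 R) (@Rpos_div R) iut).
by rewrite uE.
Qed.
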